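(* Let $k\ge 7$ and $n\ge 12k^2$ be integers, and let $\mathcal{F}\subset\binom{[n]}{k}$ be non-trivial and triangle-free. Then $$|\mathcal{F}|\le |\mathcal{T}(n,k)| = 1+\binom{n-k-1}{k-1}+\binom{n-2}{k-2}.$$
   Context: $[n]=\{1,\dots,n\}$ and $\binom{[n]}{k}$ is the collection of all $k$-element subsets of $[n]$. A family $\mathcal{F}\subset\binom{[n]}{k}$ is non-trivial if $\bigcap_{F\in\mathcal{F}}F=\emptyset$, i.e. no element of $[n]$ lies in all members of $\mathcal{F}$. Three sets $F_1,F_2,F_3$ form a triangle if $F_i\cap F_j\ne\emptyset$ for $1\le i<j\le 3$ but $F_1\cap F_2\cap F_3=\emptyset$. A family is triangle-free if no three of its members form a triangle. The family $\mathcal{T}(n,k)$ is defined as follows: fix $T_0\in\binom{[n]}{k}$ with $T_0\cap\{1,2\}=\{2\}$ and put $\mathcal{T}(n,k)=\{T_0\}\cup\{T\in\binom{[n]}{k}: 1\in T,\ T\cap T_0=\emptyset\}\cup\{T\in\binom{[n]}{k}:\{1,2\}\subset T\}$. *)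

(* Defs.v *)
From mathcomp Require Import all_boot.

Set Implicit Arguments.
Unset Strict Implicit.
Unset Printing Implicit Defensive.

(* The ground set [n] = {1, ..., n} is 'I_n, the ordinal i standing for i + 1. *)

Definition ksets (n k : nat) : {set {set 'I_n}} := [set A : {set 'I_n} | #|A| == k].

(* For the empty family the intersection is setT, hence it is trivial (n > 0). *)
Definition nontrivial (n : nat) (F : {set {set 'I_n}}) : Prop :=
  \bigcap_(A in F) A = set0.

(* The three sets are automatically distinct. *)
Definition triangle (n : nat) (A B C : {set 'I_n}) : Prop :=
  [/\ A :&: B != set0, A :&: C != set0, B :&: C != set0 & A :&: B :&: C = set0].

Definition triangle_free (n : nat) (F : {set {set 'I_n}}) : Prop :=
  forall A B C : {set 'I_n}, A \in F -> B \in F -> C \in F -> ~ triangle A B C.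

(* The singleton {i} of [n], for 1 <= i <= n (and set0 for other i). *)
Definition pt (n i : nat) : {set 'I_n} := [set x : 'I_n | x.+1 == i].

Definition Tbase (n k : nat) (T0 : {set 'I_n}) : Prop :=
  T0 \in ksets n k /\ T0 :&: (pt n 1 :|: pt n 2) = pt n 2.

Definition Tfam (n k : nat) (T0 : {set 'I_n}) : {set {set 'I_n}} :=
  T0 |: [set T in ksets n k | (pt n 1 \subset T) && (T :&: T0 == set0)]
     :|: [set T in ksets n k | pt n 1 :|: pt n 2 \subset T].

Lemma Tbase_exists (n k : nat) : 0 < k < n -> exists T0 : {set 'I_n}, Tbase k T0.
Proof.
case/andP=> k0 kn.
have inj : injective (fun i : 'I_k => Ordinal (leq_ltn_trans (ltn_ord i) kn)).
  by move=> i j [] /val_inj.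
exists [set Ordinal (leq_ltn_trans (ltn_ord i) kn) | i : 'I_k]; split.
  by rewrite inE card_imset // card_ord.
apply/setP=> x; rewrite !inE !eqSS; apply/andP/idP => [[/imsetP[i _ ->]]|x1] //=.
split; last by rewrite x1 orbT.
by apply/imsetP; exists (Ordinal k0) => //; apply/val_inj/eqP.
Qed.

(* Main.v *)
Require Import Defs.
From mathcomp Require Import all_boot.
From mathcomp Require Import zify.

(* Call [P] good if some member of F above [P] avoids any prescribed set of at most 2k points outside [P]; members of F are good, and so is any [P] of large degree. Good sets inherit triangle-freeness from F.

   For a member A and distinct x, y in A such that A - x has at least three extensions in F and A - y at least two, no member B has trace {x, y} on A: otherwise B and two exchanges of A form a triangle. Weighing (k-1)-sets by their degree, this bounds k(k-1)|F| by 2(k-1) C(n,k-1) plus the sum over ordered pairs (x, y) of the size of the family H(x,y) of those members A above {x, y} on which {x, y} is not a trace. The links of H(x,y) are intersecting, so either H(x,y) is small or all members containing x and y share a third point z(x,y). If |F| exceeds the bound, all but O(k^2 n) pairs are of the second kind, and triangle-freeness forces z to be constant, equal to c, on most of them.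

   All but a set I of at most 11k^2/4 points x are then tied to c so tightly that a member missing c meets the complement of I in at most one point. There are thus few members missing c, while every point of I, and every second member missing c, costs many members through c. *)

(** * Degrees and good sets *)

Definition up {T : finType} (F : {set {set T}}) (P : {set T}) : {set {set T}} :=
  [set A in F | P \subset A].

Definition uniform {T : finType} (k : nat) (F : {set {set T}}) : Prop :=
  forall A, A \in F -> #|A| = k.

Lemma card_ksets_between {T : finType} (P Q : {set T}) (k : nat) :
  [disjoint P & Q] -> #|P| <= k ->
  #|[set A : {set T} | [&& #|A| == k, P \subset A & [disjoint A & Q]]]|
    = 'C(#|T| - #|P| - #|Q|, k - #|P|).
Proof.
move=> dPQ lePk.
have -> : #|T| - #|P| - #|Q| = #|~: (P :|: Q)|.
  rewrite [in RHS]cardsCs setCK cardsU; move: dPQ; rewrite -setI_eq0 => /eqP ->.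
  by rewrite cards0 subn0 subnDA.
rewrite -[in RHS]cards_draws.
rewrite -[in RHS](card_in_imset (f := fun B => B :|: P)) => [|B B']; last first.
  have dB (X : {set T}) : X \subset ~: (P :|: Q) -> X = (X :|: P) :\: P.
    move=> /subsetP sX; apply/setP=> x; rewrite !inE; have := sX x; rewrite !inE.
    by case: (x \in P) => //=; [case: (x \in X) => // /(_ isT) | rewrite orbF].
  by rewrite !inE => /andP[/dB eB _] /andP[/dB eB' _] E; rewrite eB eB' E.
apply: eq_card => A; rewrite !inE; apply/and3P/imsetP.
  case=> /eqP cA sPA dAQ; exists (A :\: P).
    rewrite inE cardsDS // cA eqxx andbT; apply/subsetP=> x; rewrite !inE negb_or.
    case/andP=> -> xA /=; apply/negP=> xQ.
    by move: dAQ; rewrite -setI_eq0 => /eqP/setP/(_ x); rewrite !inE xA xQ.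
  apply/setP=> x; rewrite !inE; case xP: (x \in P) => /=; last by rewrite orbF.
  by rewrite (subsetP sPA).
case=> B; rewrite inE => /andP[sB /eqP cB] ->.
have dB : forall x, x \in B -> (x \notin P) && (x \notin Q).
  by move=> x /(subsetP sB); rewrite !inE negb_or.
split; last 1 first.
- rewrite -setI_eq0; apply/eqP/setP=> x; rewrite !inE.
  apply/negP=> /andP[/orP[/dB/andP[_ /negbTE ->]//|xP] xQ].
  by move: dPQ; rewrite -setI_eq0 => /eqP/setP/(_ x); rewrite !inE xP xQ.
- rewrite cardsU cB; have -> : B :&: P = set0.
    by apply/setP=> x; rewrite !inE; apply/negP=> /andP[/dB/andP[/negbTE -> _]].
  by rewrite cards0 subn0 subnK.
- exact: subsetUr.
Qed.

Lemma card_ksets_over {T : finType} (P : {set T}) (k : nat) : #|P| <= k ->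
  #|[set A : {set T} | (#|A| == k) && (P \subset A)]| = 'C(#|T| - #|P|, k - #|P|).
Proof.
move=> lePk; rewrite -[#|T| - _]subn0 -(cards0 T) -card_ksets_between ?disjoints0 //.
  by apply: eq_card => A; rewrite !inE disjoint_sym disjoints_subset sub0set andbT.
by rewrite disjoint_sym disjoints_subset sub0set.
Qed.

Lemma card_up {T : finType} (k : nat) (F : {set {set T}}) (P : {set T}) :
  uniform k F -> #|up F P| <= 'C(#|T| - #|P|, k - #|P|).
Proof.
move=> uF; have [lePk|ltkP] := leqP #|P| k.
  rewrite -card_ksets_over //; apply/subset_leq_card/subsetP=> A.
  by rewrite !inE => /andP[/uF -> ->]; rewrite eqxx.
have -> : up F P = set0; last by rewrite cards0.
apply/setP=> A; rewrite !inE; apply/negP=> /andP[/uF cA /subset_leq_card].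
by rewrite cA leqNgt ltkP.
Qed.

Lemma card_bigcup_le {T I : finType} (J : {set I}) (G : I -> {set T}) (m : nat) :
  (forall i, i \in J -> #|G i| <= m) -> #|\bigcup_(i in J) G i| <= #|J| * m.
Proof.
move=> leGm; apply: (@leq_trans (\sum_(i in J) #|G i|)).
  elim/big_rec2: _ => [|i s A _ leA]; first by rewrite cards0.
  by apply: leq_trans (leq_card_setU _ _) _; rewrite leq_add2l.
by rewrite -sum_nat_const leq_sum.
Qed.

Lemma card_covered_up {T : finType} (k : nat) (F : {set {set T}}) (P W : {set T}) :
  uniform k F -> [disjoint W & P] ->
  (forall A, A \in F -> P \subset A -> ~~ [disjoint A & W]) ->
  #|up F P| <= #|W| * 'C(#|T| - #|P|.+1, k - #|P|.+1).
Proof.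
move=> uF dWP hit.
apply: leq_trans (card_bigcup_le W (fun w => up F (w |: P)) _ _) => [|w wW].
  apply/subset_leq_card/subsetP=> A; rewrite inE => /andP[AF sPA].
  have := hit A AF sPA; rewrite -setI_eq0 => /set0Pn[w]; rewrite inE => /andP[wA wW].
  by apply/bigcupP; exists w => //; rewrite inE AF subUset sub1set wA.
apply: leq_trans (card_up k F (w |: P) uF) _; rewrite cardsU1.
suff -> : w \notin P by [].
by apply/negP=> wP; move: dWP; rewrite -setI_eq0 => /eqP/setP/(_ w); rewrite !inE wW wP.
Qed.

(** The budget [2 * k] is the size of two further sets of at most [k] points each, which an
    extension of [P] to a member has to avoid in [good_helly3]. *)
Definition good {T : finType} (k : nat) (F : {set {set T}}) (P : {set T}) : bool :=
  [forall W : {set T}, (#|W| <= 2 * k) ==> [disjoint W & P] ==>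
     [exists A in F, (P \subset A) && [disjoint A & W]]].

Lemma goodP {T : finType} (k : nat) (F : {set {set T}}) (P : {set T}) :
  reflect (forall W : {set T}, #|W| <= 2 * k -> [disjoint W & P] ->
             exists A, [/\ A \in F, P \subset A & [disjoint A & W]])
          (good k F P).
Proof.
apply: (iffP forallP) => [H W cW dW|H W].
  have := H W; rewrite cW dW /= => /existsP[A /and3P[AF sA dA]].
  by exists A.
apply/implyP=> cW; apply/implyP=> dW; have [A [AF sA dA]] := H W cW dW.
by apply/existsP; exists A; rewrite AF sA dA.
Qed.

(** A set [W] refuting goodness meets every member above [P], so each of them contains one of the at
    most [2 * k] extensions of [P] by a point of [W]. *)
Lemma not_good_card {T : finType} (k : nat) (F : {set {set T}}) (P : {set T}) :
  uniform k F -> ~~ good k F P -> #|up F P| <= 2 * k * 'C(#|T| - #|P|.+1, k - #|P|.+1).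
Proof.
move=> uF; rewrite negb_forall => /existsP[W].
rewrite negb_imply => /andP[cW]; rewrite negb_imply => /andP[dW nA].
apply: leq_trans (card_covered_up k F P W uF dW _) (leq_mul cW (leqnn _)).
move=> A AF sA; apply: contra nA => dA.
by apply/existsP; exists A; rewrite AF sA.
Qed.

Lemma good_mem {T : finType} (k : nat) (F : {set {set T}}) (A : {set T}) :
  A \in F -> good k F A.
Proof. by move=> AF; apply/goodP=> W _ dW; exists A; rewrite disjoint_sym. Qed.

(** Triangle-freeness in positive form, over any finite type. *)
Definition helly3 {T : finType} (F : {set {set T}}) : Prop :=
  forall A B C : {set T}, A \in F -> B \in F -> C \in F ->
    A :&: B != set0 -> A :&: C != set0 -> B :&: C != set0 -> A :&: B :&: C != set0.

Lemma disjoint_setDl {T : finType} (X P : {set T}) : [disjoint X :\: P & P].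
Proof. by rewrite -setI_eq0 setIDAC setDIl setDv setI0. Qed.

(** [P], [Q], [R] are extended in turn to members [A], [B], [C], each avoiding, outside the set it
    extends, the current forms of the other two. A point common to [A], [B], [C] must then lie in
    [R], hence in [Q], hence in [P]. *)
Lemma good_helly3 {T : finType} (k : nat) (F : {set {set T}}) (P Q R : {set T}) :
  uniform k F -> helly3 F -> good k F P -> good k F Q -> good k F R ->
  #|Q| <= k -> #|R| <= k ->
  P :&: Q != set0 -> P :&: R != set0 -> Q :&: R != set0 -> P :&: Q :&: R != set0.
Proof.
move=> uF hF /goodP gP /goodP gQ /goodP gR cQ cR nPQ nPR nQR.
have cU (X Y Z : {set T}) : #|X| <= k -> #|Y| <= k -> #|(X :|: Y) :\: Z| <= 2 * k.
  move=> cX cY; apply: leq_trans (subset_leq_card (subsetDl _ _)) _.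
  by apply: leq_trans (leq_card_setU _ _) _; rewrite mul2n -addnn leq_add.
have av (A X Z : {set T}) x : [disjoint A & X :\: Z] -> x \in A -> x \in X -> x \in Z.
  rewrite -setI_eq0 => /eqP/setP/(_ x); rewrite !inE => + xA xX.
  by rewrite xA xX andbT /=; case: (x \in Z).
have [A [AF sA dA]] := gP _ (cU Q R P cQ cR) (disjoint_setDl _ _).
have cA : #|A| <= k by rewrite (uF _ AF).
have [B [BF sB dB]] := gQ _ (cU A R Q cA cR) (disjoint_setDl _ _).
have cB : #|B| <= k by rewrite (uF _ BF).
have [C [CF sC dC]] := gR _ (cU A B R cA cB) (disjoint_setDl _ _).
have sub (X Y X' Y' : {set T}) : X \subset X' -> Y \subset Y' -> X :&: Y != set0 ->
    X' :&: Y' != set0.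
  by move=> sX sY /set0Pn[x xXY]; apply/set0Pn; exists x; apply: subsetP xXY; apply: setISS.
have /set0Pn[x] := hF A B C AF BF CF (sub _ _ _ _ sA sB nPQ) (sub _ _ _ _ sA sC nPR)
   (sub _ _ _ _ sB sC nQR).
rewrite !inE => /andP[/andP[xA xB] xC].
have xR : x \in R by apply: (av _ _ _ x dC) => //; rewrite inE xA.
have xQ : x \in Q by apply: (av _ _ _ x dB) => //; rewrite inE xA.
have xP : x \in P by apply: (av _ _ _ x dA) => //; rewrite inE xQ.
by apply/set0Pn; exists x; rewrite !inE xP xQ xR.
Qed.

(** * Intersecting families above a fixed set *)

(* Bounds the count obtained from a minimum cover of size [t], whose value at [t = 2] is the largest. *)
Lemma cover_count_decr (N l t : nat) : 2 <= t -> t <= l -> 2 * l ^ 2 <= N ->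
  t * l ^ t.-1 * 'C(N - t, l - t) <= 2 * l * 'C(N - 2, l - 2).
Proof.
move=> t2; elim: t t2 => // t IH; rewrite ltnS leq_eqVlt => /orP[/eqP <- _ _|t2 ltl hN].
  by rewrite expn1.
apply: leq_trans (IH t2 (ltnW ltl) hN).
have E : (N - t) * 'C(N - t.+1, l - t.+1) = (l - t) * 'C(N - t, l - t).
  by rewrite !subnS mul_bin_diag prednK // subn_gt0.
have Nt : 0 < N - t by nia.
rewrite -(leq_pmul2l Nt) [(N - t) * _]mulnCA E /=.
have -> : l ^ t = l * l ^ t.-1 by rewrite -expnS prednK //; apply: ltn_trans t2.
rewrite mulnA [in X in _ <= X]mulnA leq_mul2r; apply/orP; right.
move: (l ^ t.-1) => w.
have h1 : 3 * (l * (l - t)) <= 2 * (N - t) by nia.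
have h2 : 2 * t.+1 <= 3 * t by lia.
have h3 : t.+1 * (l * (l - t)) <= t * (N - t).
  by have := leq_mul h1 h2; rewrite -(@leq_pmul2l 6) //; nia.
by have := leq_mul h3 (leqnn w); nia.
Qed.

(** While [S] has fewer than [t] points it is not a cover, so some member [A] misses it. Every
    member above [P :|: S] meets [A] outside [P], which leaves [k - #|P|] choices for a next point
    of [S]. After [d] such steps the trivial degree bound applies. *)
Lemma card_up_branch {T : finType} (k t d : nat) (G : {set {set T}}) (P S : {set T}) :
  uniform k G -> (forall A, A \in G -> P \subset A) ->
  (forall A B, A \in G -> B \in G -> A :&: B != P) ->
  (forall S : {set T}, [disjoint S & P] ->
     (forall A, A \in G -> ~~ [disjoint A & S]) -> t <= #|S|) ->
  [disjoint S & P] -> #|S| + d = t ->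
  #|up G (P :|: S)| <= (k - #|P|) ^ d * 'C(#|T| - #|P| - t, k - #|P| - t).
Proof.
move=> uG sG iG minS; elim: d S => [|d IH] S dS cS.
  rewrite expn0 mul1n; apply: leq_trans (card_up k G _ uG) _.
  have -> : #|P :|: S| = #|P| + t.
    by rewrite cardsU setIC; move: dS; rewrite -setI_eq0 => /eqP ->; rewrite cards0; lia.
  by rewrite !subnDA.
have [A AG dA] : exists2 A, A \in G & [disjoint A & S].
  have [/existsP[A /andP[AG dA]]|/existsPn n] := boolP [exists A in G, [disjoint A & S]].
    by exists A.
  suff : t <= #|S| by lia.
  by apply: minS => // A AG; have := n A; rewrite AG.
have cA : #|A :\: P| = k - #|P| by rewrite cardsDS ?sG ?(uG A).
rewrite expnS -mulnA -cA.
apply: leq_trans (card_bigcup_le (A :\: P) (fun a => up G (P :|: (a |: S))) _ _).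
  apply/subset_leq_card/subsetP=> B; rewrite inE subUset => /andP[BG /andP[sPB sSB]].
  have : ~~ (A :&: B \subset P).
    apply: contra (iG A B AG BG) => s; rewrite eqEsubset s subsetI sPB andbT; exact: sG.
  case/subsetPn=> a; rewrite inE => /andP[aA aB] aP.
  apply/bigcupP; exists a; first by rewrite inE aP aA.
  by rewrite inE BG !subUset sPB sub1set aB sSB.
move=> a; rewrite inE => /andP[aP aA]; rewrite cA.
have aS : a \notin S.
  by apply/negP=> aS; move: dA; rewrite -setI_eq0 => /eqP/setP/(_ a); rewrite !inE aA aS.
apply: IH; last by rewrite cardsU1 aS; lia.
by rewrite -setI_eq0 setIUl setU_eq0 setI_eq0 disjoints1 aP setI_eq0.
Qed.

(* A minimum cover of the traces outside [P], of size [t >= 2], is refined [t - 1] times by branching on a member that the current set misses. *)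
Lemma intersecting_over {T : finType} (k : nat) (G : {set {set T}}) (P : {set T}) :
  uniform k G -> (forall A, A \in G -> P \subset A) ->
  (forall A B, A \in G -> B \in G -> A :&: B != P) ->
  2 * (k - #|P|) ^ 2 <= #|T| - #|P| ->
  (exists2 z, z \notin P & forall A, A \in G -> z \in A) \/
  #|G| <= 2 * (k - #|P|) * 'C(#|T| - #|P| - 2, k - #|P| - 2).
Proof.
move=> uG sG iG hN; have [->|[A0 A0G]] := set_0Vmem G; first by right; rewrite cards0.
pose cov (S : {set T}) := [disjoint S & P] && [forall A in G, ~~ [disjoint A & S]].
have cov0 : cov (A0 :\: P).
  rewrite /cov disjoint_setDl; apply/forall_inP=> B BG.
  apply: contra (iG A0 B A0G BG) => dB; rewrite eqEsubset subsetI !sG // !andbT.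
  apply/subsetP=> x; rewrite inE => /andP[xA xB]; apply/negPn/negP=> xP.
  by move: dB; rewrite -setI_eq0 => /eqP/setP/(_ x); rewrite !inE xA xB xP.
case: (@arg_minnP _ (A0 :\: P) cov (fun S => #|S|) cov0) => S /andP[dS /forall_inP hS] minS.
have S_le : #|S| <= k - #|P| by rewrite -(uG _ A0G) -cardsDS ?sG ?minS.
have minS' (S' : {set T}) : [disjoint S' & P] ->
    (forall A, A \in G -> ~~ [disjoint A & S']) -> #|S| <= #|S'|.
  by move=> d h; apply: minS; rewrite /cov d; apply/forall_inP.
have [le1|gt1] := leqP #|S| 1.
  left; have /set0Pn[z] : A0 :&: S != set0 by rewrite setI_eq0 hS.
  rewrite inE => /andP[_ zS]; have {le1} eS : S = [set z].
    by apply/esym/eqP; rewrite eqEcard sub1set zS cards1.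
  exists z; first by move: dS; rewrite eS disjoints1.
  by move=> A /hS; rewrite eS disjoint_sym disjoints1 negbK.
right; apply: leq_trans (cover_count_decr _ _ _ gt1 S_le hN).
rewrite -mulnA.
apply: leq_trans (card_bigcup_le S (fun u => up G (P :|: [set u])) _ _) => [|u uS].
  apply/subset_leq_card/subsetP=> A AG; have := hS A AG.
  rewrite -setI_eq0 => /set0Pn[u]; rewrite inE => /andP[uA uS].
  by apply/bigcupP; exists u => //; rewrite inE AG subUset sG // sub1set.
apply: card_up_branch => //; last by rewrite cards1; lia.
rewrite disjoints1; apply/negP=> uP.
by move: dS; rewrite -setI_eq0 => /eqP/setP/(_ u); rewrite !inE uS uP.
Qed.

(** * Traces of size two *)

Definition nonkernel {T : finType} (F : {set {set T}}) (A : {set T}) (x y : T) : bool :=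
  [forall B in F, B :&: A != [set x; y]].

Lemma eq_setD1_card {T : finType} (A B : {set T}) (x : T) :
  #|A| = #|B| -> A :\ x \subset B -> x \in A -> x \in B -> B = A.
Proof.
move=> cAB sAB xA xB; apply/esym/eqP; rewrite eqEcard cAB leqnn andbT.
apply/subsetP=> z zA; have [->//|nzx] := eqVneq z x.
by apply: (subsetP sAB); rewrite !inE nzx.
Qed.

Lemma eq_setD1_card2 {T : finType} (A B : {set T}) (x v : T) :
  #|A| = #|B| -> A :\ x \subset B -> x \in A -> v \in B -> v \notin A -> B = v |: (A :\ x).
Proof.
move=> cAB sAB xA vB vA; apply/esym/eqP; rewrite eqEcard subUset sub1set vB sAB /=.
have vD : v \notin A :\ x by rewrite !inE (negbTE vA) andbF.
by rewrite cardsU1 vD -cAB (cardsD1 x A) xA.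
Qed.

(** If [B] had trace [[set x; y]] on [A], it would form a triangle with an exchange [A1] of [x] and
    an exchange [A2] of [y], provided these bring in different new points. The third extension of
    [A :\ x] serves to make them different. *)
Lemma nonkernelP {T : finType} (k : nat) (F : {set {set T}}) (A : {set T}) (x y : T) :
  uniform k F -> helly3 F -> 3 <= k -> A \in F -> x \in A -> y \in A -> x != y ->
  2 < #|up F (A :\ x)| -> 1 < #|up F (A :\ y)| -> nonkernel F A x y.
Proof.
move=> uF hF k3 AF xA yA nxy dx dy; apply/forall_inP=> B BF; apply/eqP=> eB.
have cF C : C \in F -> #|A| = #|C| by move=> /uF ->; rewrite (uF A).
have [A2 /andP[A2F sA2] nA2] : exists2 A2, (A2 \in F) && (A :\ y \subset A2) & A2 != A.
  have : 0 < #|up F (A :\ y) :\ A|.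
    rewrite -ltnS; apply: leq_trans dy _; rewrite (cardsD1 A (up F (A :\ y))).
    by case: (_ \in _).
  by case/card_gt0P=> A2; rewrite !inE => /andP[n h]; exists A2.
(* [B2] is the exchange of [x] for the new point of [A2], to be avoided by [A1]. The default [A] is
   harmless, as [A1] must differ from [A] anyway. *)
pose B2 := if [pick v in A2 :\: A] is Some v then v |: (A :\ x) else A.
have [A1 /andP[A1F sA1] /andP[nA1 nB2]] : exists2 A1,
    (A1 \in F) && (A :\ x \subset A1) & (A1 != A) && (A1 != B2).
  have : 0 < #|up F (A :\ x) :\ A :\ B2|.
    rewrite -(ltn_add2l 2); apply: leq_trans dx _.
    rewrite (cardsD1 A (up F (A :\ x))) (cardsD1 B2 (_ :\ A)).
    by rewrite addnA leq_add2r; case: (A \in _); case: (B2 \in _).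
  by case/card_gt0P=> A1; rewrite !inE => /and3P[n1 n2 h]; exists A1; rewrite ?h ?n1 ?n2.
have xA1 : x \notin A1.
  by apply: contra nA1 => xA1; apply/eqP/(eq_setD1_card A A1 x) => //; apply: cF.
have yA2 : y \notin A2.
  by apply: contra nA2 => yA2; apply/eqP/(eq_setD1_card A A2 y) => //; apply: cF.
have inB z : (z \in B) && (z \in A) = (z == x) || (z == y).
  by move/setP/(_ z): eB; rewrite !inE.
have /andP[xB _] : (x \in B) && (x \in A) by rewrite inB eqxx.
have /andP[yB _] : (y \in B) && (y \in A) by rewrite inB eqxx orbT.
have xA2 : x \in A2 by apply: (subsetP sA2); rewrite !inE nxy.
have yA1 : y \in A1 by apply: (subsetP sA1); rewrite !inE eq_sym nxy.
(* The pairs meet in [y], in [x], and in a third point of [A]. *)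
have : B :&: A1 :&: A2 != set0.
  apply: hF => //; apply/set0Pn.
  - by exists y; rewrite inE yB.
  - by exists x; rewrite inE xB.
  have : 0 < #|A :\ x :\ y|.
    have := uF A AF; rewrite (cardsD1 x A) xA (cardsD1 y (A :\ x)) !inE eq_sym nxy yA /= => cA.
    by move: cA k3; clear; lia.
  case/card_gt0P=> z; rewrite !inE => /and3P[nzy nzx zA].
  exists z; rewrite inE; apply/andP; split.
    by apply: (subsetP sA1); rewrite !inE nzx.
  by apply: (subsetP sA2); rewrite !inE nzy.
case/set0Pn=> v; rewrite !inE => /andP[/andP[vB vA1] vA2].
(* Inside [A] the common point would be [x] or [y], missed by [A1] and [A2] respectively. Outside
   [A] it is the new point of both exchanges, so that [A1] is [B2]. *)
have [vA|vA] := boolP (v \in A).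
  have := inB v; rewrite vB vA => /esym/orP[]/eqP e; first by rewrite -e vA1 in xA1.
  by rewrite -e vA2 in yA2.
have e1 := eq_setD1_card2 A A1 x v (cF _ A1F) sA1 xA vA1 vA.
have e2 := eq_setD1_card2 A A2 y v (cF _ A2F) sA2 yA vA2 vA.
case/eqP: nB2; rewrite /B2; case: pickP => [w|/(_ v)]; last by rewrite !inE vA vA2.
rewrite !inE {1}e2 !inE => /andP[wA /orP[/eqP ->//|/andP[_ wA']]].
by rewrite wA' in wA.
Qed.

(* [3 - d] is [2, 1, 0, 0, ...] at [d = 1, 2, 3, 4, ...], at most [2 / d]. *)
Lemma local_count {T : finType} (k : nat) (F : {set {set T}}) (A : {set T}) :
  uniform k F -> helly3 F -> 3 <= k -> A \in F ->
  k * (k - 1) <= (k - 1) * \sum_(x in A) (3 - #|up F (A :\ x)|)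
    + \sum_(x in A) \sum_(y in A :\ x) nonkernel F A x y.
Proof.
move=> uF hF k3 AF; pose w x := 3 - #|up F (A :\ x)|.
have cA1 x : x \in A -> #|A :\ x| = k - 1.
  by move=> xA; rewrite -(uF A AF) (cardsD1 x A) xA addKn.
have E1 : \sum_(x in A) \sum_(y in A :\ x) 2 = 2 * (k * (k - 1)).
  rewrite (eq_bigr (fun _ => (k - 1) * 2)) => [|x xA]; last by rewrite sum_nat_const cA1.
  by rewrite sum_nat_const (uF A AF); lia.
have E2 : \sum_(x in A) \sum_(y in A :\ x) w x = (k - 1) * \sum_(x in A) w x.
  by rewrite big_distrr /=; apply: eq_bigr => x xA; rewrite sum_nat_const cA1.
have E3 : \sum_(x in A) \sum_(y in A :\ x) w y = (k - 1) * \sum_(x in A) w x.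
  rewrite -E2 (exchange_big_dep (mem A)) /=; last by move=> x y _; rewrite !inE => /andP[].
  apply: eq_bigr => x xA; apply: eq_bigl => y; rewrite !inE eq_sym xA andbT andbC //.
(* If [nonkernel] fails, [nonkernelP] in both orders leaves two cases: one of the two degrees is at
   most 1 and has weight at least 2, or both are at most 2 and each has weight at least 1. *)
have : \sum_(x in A) \sum_(y in A :\ x) 2 <=
  \sum_(x in A) \sum_(y in A :\ x) (w x + w y + 2 * nonkernel F A x y).
  apply: leq_sum => x xA; apply: leq_sum => y; rewrite !inE => /andP[nyx yA].
  have [|] := boolP (nonkernel F A x y); first lia.
  move=> nk; have nxy : x != y by rewrite eq_sym.
  have yx : nonkernel F A y x = nonkernel F A x y.
    by apply: eq_forallb => B; rewrite setUC.
  have h1 : ~~ ((2 < #|up F (A :\ x)|) && (1 < #|up F (A :\ y)|)).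
    by apply: contra nk => /andP[d1 d2]; apply: (nonkernelP k).
  rewrite -yx in nk.
  have h2 : ~~ ((2 < #|up F (A :\ y)|) && (1 < #|up F (A :\ x)|)).
    by apply: contra nk => /andP[d1 d2]; apply: (nonkernelP k).
  by rewrite /w; move: h1 h2; clear; lia.
have -> : \sum_(x in A) \sum_(y in A :\ x) (w x + w y + 2 * nonkernel F A x y) =
  \sum_(x in A) \sum_(y in A :\ x) w x + \sum_(x in A) \sum_(y in A :\ x) w y +
  2 * \sum_(x in A) \sum_(y in A :\ x) nonkernel F A x y.
  rewrite big_distrr -!big_split /=; apply: eq_bigr => x _.
  by rewrite big_distrr -!big_split.
rewrite E1 E2 E3 -[in X in _ -> X]/(\sum_(x in A) w x).
move: (\sum_(x in A) w x) (\sum_(x in A) _) => W N; rewrite addnn -mul2n -mulnDr.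
by rewrite leq_pmul2l.
Qed.

(** A (k-1)-set of degree [d] is counted by [d] members with weight [3 - d], and [d * (3 - d) <= 2]
    for every [d]. *)
Lemma own_count {T : finType} (k : nat) (F : {set {set T}}) : uniform k F -> 0 < k ->
  \sum_(A in F) \sum_(x in A) (3 - #|up F (A :\ x)|) <= 2 * 'C(#|T|, k - 1).
Proof.
move=> uF k0; pose f (P : {set T}) := 3 - #|up F P|.
have -> : 2 * 'C(#|T|, k - 1) = \sum_(P : {set T} | #|P| == k - 1) 2.
  by rewrite sum_nat_const -card_draws mulnC cardsE.
apply: (@leq_trans (\sum_(A in F) \sum_(P : {set T} | (#|P| == k - 1) && (P \subset A)) f P)).
  apply: leq_sum => A AF.
  have inj : {in A &, injective (fun x => A :\ x)}.
    move=> x y xA yA /= e; apply/eqP; move/setP/(_ x): e.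
    by rewrite !inE eqxx xA andbT; case: (x == y).
  rewrite -(big_imset f inj) /= [leqRHS](bigID (mem [set A :\ x | x in A])) /=.
  apply: leq_trans (leq_addr _ _); apply: eq_leq; apply: eq_bigl => P.
  apply/idP/andP=> [h|[]//]; split=> //; case/imsetP: h => x xA ->.
  by rewrite subD1set andbT -(uF A AF) (cardsD1 x A) xA addKn.
rewrite (exchange_big_dep (fun P : {set T} => #|P| == k - 1)) /=; last by move=> ? ? _ /andP[].
apply: leq_sum => P cP; rewrite (eq_bigl (mem (up F P))) => [|A].
  by rewrite sum_nat_const /f; nia.
by rewrite /= inE cP.
Qed.

(* [H(x,y)] of the header. *)
Definition nkpair {T : finType} (F : {set {set T}}) (x y : T) : {set {set T}} :=
  [set A in F | [&& x \in A, y \in A & nonkernel F A x y]].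

Lemma global_count {T : finType} (k : nat) (F : {set {set T}}) :
  uniform k F -> helly3 F -> 3 <= k ->
  k * (k - 1) * #|F| <= 2 * (k - 1) * 'C(#|T|, k - 1)
    + \sum_x \sum_(y | y != x) #|nkpair F x y|.
Proof.
move=> uF hF k3.
have -> : \sum_x \sum_(y | y != x) #|nkpair F x y| =
  \sum_(A in F) \sum_(x in A) \sum_(y in A :\ x) nonkernel F A x y.
  rewrite [RHS](exchange_big_dep xpredT) //=; apply: eq_bigr => x _.
  rewrite [RHS](exchange_big_dep (fun y => y != x)) /=; last first.
    by move=> A y _; rewrite !inE => /andP[].
  apply: eq_bigr => y nyx; rewrite -sum1_card big_mkcond [RHS]big_mkcond /=.
  apply: eq_bigr => A _; rewrite !inE nyx /=.
  by case: (A \in F); case: (x \in A); case: (y \in A); case: nonkernel.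
rewrite mulnC -sum_nat_const.
apply: (@leq_trans (\sum_(A in F) ((k - 1) * (\sum_(x in A) (3 - #|up F (A :\ x)|))
    + \sum_(x in A) \sum_(y in A :\ x) nonkernel F A x y))).
  by apply: leq_sum => A AF; apply: local_count.
rewrite big_split /= leq_add2r -big_distrr /= [2 * _]mulnC -mulnA leq_mul2l.
by rewrite own_count ?orbT // (leq_trans _ k3).
Qed.

(** * Heavy pairs and lines *)

(** The threshold is the bound of [not_good_card] for three-point sets. It also dominates the small
    alternative of [intersecting_over] above two points. *)
Definition heavy {T : finType} (k : nat) (F : {set {set T}}) (x y : T) : bool :=
  2 * k * 'C(#|T| - 4, k - 4) < #|nkpair F x y|.

(** Here [z] is the point z(x,y) of the header; the last clause makes the triple good. *)
Definition line {T : finType} (k : nat) (F : {set {set T}}) (x y z : T) : Prop :=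
  [/\ x != y, z != x, z != y,
      forall A, A \in F -> x \in A -> y \in A -> z \in A
    & 2 * k * 'C(#|T| - 4, k - 4) < #|up F [set x; y; z]|].

Lemma nkpair_sym {T : finType} (F : {set {set T}}) (x y : T) : nkpair F x y = nkpair F y x.
Proof.
apply/setP=> A; rewrite !inE; congr (_ && _); rewrite andbCA; congr (_ && (_ && _)).
by apply: eq_forallb => B; rewrite setUC.
Qed.

Lemma heavy_sym {T : finType} (k : nat) (F : {set {set T}}) (x y : T) :
  heavy k F x y = heavy k F y x.
Proof. by rewrite /heavy nkpair_sym. Qed.

Lemma line_sym {T : finType} (k : nat) (F : {set {set T}}) (x y z : T) :
  line k F x y z -> line k F y x z.
Proof.
case=> nxy nzx nzy clo cnt; split=> //; first by rewrite eq_sym.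
  by move=> A AF yA xA; apply: clo.
by rewrite [[set y; x]]setUC.
Qed.

Lemma cards3 {T : finType} (x y z : T) :
  x != y -> z != x -> z != y -> #|[set x; y; z]| = 3.
Proof.
by move=> nxy nzx nzy; rewrite setUC cardsU1 !inE (negbTE nzx) (negbTE nzy) cards2 nxy.
Qed.

Lemma good_line {T : finType} (k : nat) (F : {set {set T}}) (x y z : T) :
  uniform k F -> line k F x y z -> good k F [set x; y; z].
Proof.
move=> uF [nxy nzx nzy _ cnt]; apply: contraLR cnt => /(not_good_card k F _ uF).
by rewrite cards3 // leqNgt.
Qed.

(** Heaviness rules out the small alternative of [intersecting_over], so H(x,y) has a common third
    point [z]. If a member [A] through [x] and [y] missed [z], every member of H(x,y) would meet [A]
    outside the triple, its trace on [A] not being [[set x; y]]. The at most [k] points of [A] would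
    then cover H(x,y), which makes it too small. *)
Lemma heavy_line {T : finType} (k : nat) (F : {set {set T}}) (x y : T) :
  uniform k F -> x != y -> 2 * (k - 2) ^ 2 <= #|T| - 2 ->
  heavy k F x y -> exists z, line k F x y z.
Proof.
move=> uF nxy hn hv.
have uH : uniform k (nkpair F x y) by move=> A; rewrite inE => /andP[/uF].
have c2 : #|[set x; y]| = 2 by rewrite cards2 nxy.
case: (intersecting_over k (nkpair F x y) [set x; y] uH).
- by move=> A; rewrite inE subUset !sub1set => /and4P[_ -> ->].
- move=> A B; rewrite !inE => /andP[AF _] /and4P[_ _ _ /forall_inP nk].
  exact: nk.
- by rewrite c2.
- case=> z; rewrite !inE negb_or => /andP[nzx nzy] zH; exists z; split=> //; last first.
    apply: leq_trans hv _; apply/subset_leq_card/subsetP=> A AH; have zA := zH A AH.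
    by move: AH; rewrite !inE !subUset !sub1set zA andbT => /and4P[-> -> ->].
  move=> A AF xA yA; apply: contraLR hv => zA; rewrite -leqNgt.
  have -> : nkpair F x y = up (nkpair F x y) [set x; y; z].
    apply/setP=> B; rewrite [RHS]inE; case BH: (B \in _) => //=.
    rewrite !subUset !sub1set zH // andbT; apply/esym.
    by move: BH; rewrite inE => /and4P[_ -> ->].
  have c3 := cards3 x y z nxy nzx nzy.
  have := card_covered_up k (nkpair F x y) [set x; y; z] (A :\: [set x; y; z]) uH
    (disjoint_setDl _ _).
  rewrite c3 => h; apply: leq_trans (h _) _ => [B|].
    rewrite inE => /and4P[BF xB yB /forall_inP/(_ A AF) nk] _.
    have : ~~ (A :&: B \subset [set x; y]).
      apply: contra nk => s; rewrite eqEsubset s subUset !sub1set !inE xA yA xB yB //.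
    case/subsetPn=> w; rewrite !inE negb_or => /andP[wA wB] /andP[nwx nwy].
    rewrite -setI_eq0; apply/set0Pn; exists w; rewrite !inE wB wA (negbTE nwx) (negbTE nwy).
    by rewrite andbT /=; apply: contra zA => /eqP <-.
  apply: leq_mul => //; apply: leq_trans (subset_leq_card (subsetDl _ _)) _.
  by rewrite (uF A AF); lia.
- rewrite c2 -!subnDA => le; suff : 2 * k * 'C(#|T| - 4, k - 4) < 2 * k * 'C(#|T| - 4, k - 4).
    by rewrite ltnn.
  apply: leq_trans hv _; apply: leq_trans le _.
  by apply: leq_mul => //; apply: leq_mul => //; apply: leq_subr.
Qed.

Lemma card_nkpair {T : finType} (k : nat) (F : {set {set T}}) (x y : T) :
  uniform k F -> x != y -> 2 * (k - 2) ^ 2 <= #|T| - 2 ->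
  #|nkpair F x y| <= if heavy k F x y then 'C(#|T| - 3, k - 3)
                     else 2 * k * 'C(#|T| - 4, k - 4).
Proof.
move=> uF nxy hn; case: ifP => [hv|]; last by move/negbT; rewrite -leqNgt.
have [z [_ nzx nzy clo _]] := heavy_line k F x y uF nxy hn hv.
rewrite -(cards3 x y z nxy nzx nzy); apply: leq_trans (card_up k F _ uF).
apply/subset_leq_card/subsetP=> A; rewrite !inE !subUset !sub1set.
by case/and4P=> AF xA yA _; rewrite AF xA yA clo.
Qed.

(** The three triples are good and meet pairwise, hence share a point. If it is [z], then [z' = z].
    Otherwise [u = x] or [z' = y], and a good triple inside [x], [y], [y'] forces [z] as a fourth
    point. *)
Lemma line_triangle {T : finType} (k : nat) (F : {set {set T}}) (x y y' z z' u : T) :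
  uniform k F -> helly3 F -> 3 < k ->
  line k F x y z -> line k F x y' z' -> line k F y y' u -> y' != z -> z' = z.
Proof.
move=> uF hF k3 l1 l2 l3 ny'z.
have [[nxy nzx nzy c1 n1] [nxy' nz'x nz'y' c2 n2] [nyy' nuy nuy' c3 n3]] := And3 l1 l2 l3.
(* A triple that forces a fourth point has degree at most ['C(#|T| - 4, k - 4)], below the
   threshold. *)
have big (s x1 x2 x3 : T) : s \notin [set x1; x2; x3] -> x1 != x2 -> x3 != x1 -> x3 != x2 ->
    (forall A, A \in F -> x1 \in A -> x2 \in A -> x3 \in A -> s \in A) ->
    2 * k * 'C(#|T| - 4, k - 4) < #|up F [set x1; x2; x3]| -> False.
  move=> sP n12 n31 n32 clo; apply/negP; rewrite -leqNgt.
  have c4 : #|s |: [set x1; x2; x3]| = 4 by rewrite cardsU1 sP cards3.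
  apply: leq_trans (subset_leq_card _) (leq_trans (card_up k F (s |: [set x1; x2; x3]) uF) _).
    apply/subsetP=> A; rewrite !inE !subUset !sub1set.
    by case/andP=> AF /andP[/andP[x1A x2A] x3A]; rewrite AF x1A x2A x3A clo.
  by rewrite c4 leq_pmull // muln_gt0 (ltn_trans _ k3).
have := good_helly3 k F [set x; y; z] [set x; y'; z'] [set y; y'; u] uF hF
  (good_line k F x y z uF l1) (good_line k F x y' z' uF l2) (good_line k F y y' u uF l3).
rewrite !cards3 // => /(_ (ltnW k3) (ltnW k3)) h.
have /set0Pn[v] : [set x; y; z] :&: [set x; y'; z'] :&: [set y; y'; u] != set0.
  apply: h; apply/set0Pn.
  - by exists x; rewrite !inE eqxx.
  - by exists y; rewrite !inE eqxx orbT.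
  - by exists y'; rewrite !inE eqxx !orbT.
rewrite !inE -!orbA => /andP[/andP[/or3P[]/eqP-> v2 v3]].
- move: v3; rewrite (negbTE nxy) (negbTE nxy') /= => /eqP e; subst u.
  exfalso; apply: (big z y y' x _ nyy' nxy nxy' _ n3).
    by rewrite !inE (negbTE nzx) (negbTE nzy) (eq_sym z) (negbTE ny'z).
  by move=> A AF yA _ xA; apply: c1.
- move: v2; rewrite eq_sym (negbTE nxy) (negbTE nyy') /= => /eqP e; subst z'.
  have nyx : y != x by rewrite eq_sym.
  exfalso; apply: (big z x y' y _ nxy' nyx nyy' _ n2); last first.
    by move=> A AF xA _ yA; apply: c1.
  by rewrite !inE (negbTE nzx) (negbTE nzy) (eq_sym z) (negbTE ny'z).
- by move: v2; rewrite (negbTE nzx) (eq_sym z) (negbTE ny'z) /= => /eqP.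
Qed.

(** * Binomial estimates *)

Lemma bin_diag (n k : nat) : 0 < k -> 0 < n -> n * 'C(n - 1, k - 1) = k * 'C(n, k).
Proof. by move=> k0 n0; rewrite !subn1 mul_bin_diag prednK. Qed.

(** Pascal's rule, applied [d] times, adds [d] terms; the largest bounds them here, the smallest in
    [bin_add_ge]. *)
Lemma bin_add_le (m d r : nat) : 'C(m + d, r.+1) <= 'C(m, r.+1) + d * 'C(m + d - 1, r).
Proof.
elim: d => [|d IH]; first by rewrite addn0 leq_addr.
rewrite addnS binS subn1 /= mulSn addnCA addnC leq_add2l.
apply: leq_trans IH _; rewrite leq_add2l leq_mul2l leq_bin2l ?orbT //; lia.
Qed.

Lemma bin_add_ge (m d r : nat) : 'C(m, r.+1) + d * 'C(m, r) <= 'C(m + d, r.+1).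
Proof.
elim: d => [|d IH]; first by rewrite addn0 addn0.
by rewrite addnS binS mulSn addnCA addnC leq_add // leq_bin2l // leq_addr.
Qed.

(** Factor by factor, (i - j) / (m - j) is at most i / m. *)
Lemma bin_ratio (i m r : nat) : i <= m -> 'C(i, r) * m ^ r <= i ^ r * 'C(m, r).
Proof.
move=> lim; elim: r => [|r IH]; first by rewrite !bin0.
have E j : r.+1 * 'C(j, r.+1) = (j - r) * 'C(j, r).
  have [ltrj|] := ltnP r j; last first.
    by move=> h; rewrite bin_small // (_ : j - r = 0) ?muln0 //; lia.
  by rewrite mul_bin_left.
rewrite -(@leq_pmul2l r.+1) // mulnA E mulnCA E !expnS.
have h : (i - r) * m <= i * (m - r) by nia.
have := leq_mul h IH; lia.
Qed.

(** The last comparison in the bound [5 * k ^ 2 * n / 4] on the number of non-heavy ordered pairs.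
    [h1] is the case [n = 12 * k ^ 2] in essence, and [h2] says that the ratio of [n - 3] to
    [n - 3 - 2 * k * (k - 3)] is largest there. *)
Lemma nonheavy_poly (n k : nat) : 7 <= k -> 12 * k ^ 2 <= n ->
  4 * ((n - 2) * (n - 3) * (k * (k - 1) ^ 2 + 4 * k - 4))
    <= 5 * k ^ 2 * n * ((k - 2) * (n - 3 - 2 * k * (k - 3))).
Proof.
move=> hk hn.
have [j ej] : exists j, k = j + 7 by exists (k - 7); lia.
have [m em] : exists m, n = 12 * k ^ 2 + m by exists (n - 12 * k ^ 2); lia.
have B_j : k * (k - 1) ^ 2 + 4 * k - 4 = j ^ 3 + 19 * j ^ 2 + 124 * j + 276.
  have -> : k - 1 = j + 6 by lia.
  by rewrite -[RHS](addnK 4) ej; congr (_ - _); lia.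
have a_j : 12 * k ^ 2 - 3 = 12 * j ^ 2 + 168 * j + 585.
  by rewrite -[RHS](addnK 3) ej; congr (_ - _); lia.
have b_j : 10 * k ^ 2 + 6 * k - 3 = 10 * j ^ 2 + 146 * j + 529.
  by rewrite -[RHS](addnK 3) ej; congr (_ - _); lia.
have h1 : 4 * (k * (k - 1) ^ 2 + 4 * k - 4) * (12 * k ^ 2 - 3)
    <= 5 * k ^ 2 * (k - 2) * (10 * k ^ 2 + 6 * k - 3).
  rewrite B_j a_j b_j (_ : k - 2 = j + 5) ?ej; last by lia.
  (* The difference of the two sides is a polynomial in [j] with nonnegative coefficients. *)
  rewrite [leqRHS](_ : _ = 4 * (j ^ 3 + 19 * j ^ 2 + 124 * j + 276)
    * (12 * j ^ 2 + 168 * j + 585)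
    + (2185 + (4 * 4000 + 1973) * j + (2 * 4000 + 339) * j ^ 2 + 1405 * j ^ 3 + 96 * j ^ 4 + 2 * j ^ 5)).
    by rewrite leq_addr.
  by lia.
have h2 : (n - 3) * (10 * k ^ 2 + 6 * k - 3) <= (n - 3 - 2 * k * (k - 3)) * (12 * k ^ 2 - 3).
  have -> : n - 3 = 12 * j ^ 2 + 168 * j + 585 + m by rewrite em -a_j addnBAC //; move: hk; clear; nia.
  have -> : 2 * k * (k - 3) = 2 * j ^ 2 + 22 * j + 56.
    have -> : k - 3 = j + 4 by lia.
    by rewrite ej; lia.
  have -> : 12 * j ^ 2 + 168 * j + 585 + m - (2 * j ^ 2 + 22 * j + 56)
    = 10 * j ^ 2 + 146 * j + 529 + m.
    by rewrite -[RHS](addnK (2 * j ^ 2 + 22 * j + 56)); congr (_ - _); lia.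
  have : 10 * j ^ 2 + 146 * j + 529 <= 12 * j ^ 2 + 168 * j + 585 by lia.
  rewrite a_j b_j; move: (12 * _ + _ + _) (10 * _ + _ + _) => a b; clear; nia.
have p : 0 < 12 * k ^ 2 - 3 by rewrite a_j addn_gt0 orbT.
rewrite -(leq_pmul2l p); move: h1 h2; clear.
have : n - 2 <= n by lia.
move: (12 * k ^ 2 - 3) (10 * _ ^ 2 + _ - 3) (n - 3 - _) (k * _ + _ - 4) => a b c d hvn h1 h2.
have := leq_mul (leq_mul h1 (leqnn (n - 3))) (leqnn (n - 2)).
have := leq_mul (leq_mul (leqnn (5 * k ^ 2 * (k - 2))) h2) (leqnn n).
move: hvn; move: (n - 3) (n - 2) (k - 2) (k ^ 2) => u v w z hvn H1 H2.
have H3 := leq_mul (leqnn (5 * z * w * b * u)) hvn.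
lia.
Qed.

(** [f] stands for the size of F, [Q] for the number of non-heavy ordered pairs and [S] for the sum
    of the sizes of H(x,y). A non-heavy pair loses most of the ['C(n - 3, k - 3)] allowed to a pair,
    and [global_count] leaves little room for such losses. *)
Lemma nonheavy_arith (n k f Q S : nat) : 7 <= k -> 12 * k ^ 2 <= n ->
  'C(n - k - 1, k - 1) + 'C(n - 2, k - 2) <= f ->
  k * (k - 1) * f <= 2 * (k - 1) * 'C(n, k - 1) + S ->
  S + Q * 'C(n - 3, k - 3) <= n * (n - 1) * 'C(n - 3, k - 3) + Q * (2 * k * 'C(n - 4, k - 4)) ->
  4 * Q <= 5 * k ^ 2 * n.
Proof.
move=> hk hn hf h1 h2.
have hkn : k + 10 <= n by move: hk hn; clear; nia.
have e1 : (n - 1) * 'C(n - 2, k - 2) = (k - 1) * 'C(n - 1, k - 1).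
  by rewrite -bin_diag ?subn_gt0; [congr (_ * 'C(_, _)); lia | lia | lia].
have e2 : (n - 2) * 'C(n - 3, k - 3) = (k - 2) * 'C(n - 2, k - 2).
  by rewrite -bin_diag ?subn_gt0; [congr (_ * 'C(_, _)); lia | lia | lia].
have e3 : (n - 3) * 'C(n - 4, k - 4) = (k - 3) * 'C(n - 3, k - 3).
  by rewrite -bin_diag ?subn_gt0; [congr (_ * 'C(_, _)); lia | lia | lia].
have e4 : (n - (k - 1)) * 'C(n, k - 1) = n * 'C(n - 1, k - 1).
  by rewrite -mul_bin_down -subn1.
have e5 : 'C(n - 1, k - 1) <= 'C(n - k - 1, k - 1) + k * 'C(n - 2, k - 2).
  have := bin_add_le (n - k - 1) k (k - 2).
  have -> : (k - 2).+1 = k - 1 by lia.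
  have -> : n - k - 1 + k = n - 1 by move: hkn; clear; lia.
  by have -> : n - 1 - 1 = n - 2 by lia.
have pc : 0 < 'C(n - 2, k - 2) by rewrite bin_gt0; move: hk hkn; clear; lia.
move: e1 e2 e3 e4 e5 hf h1 h2 pc.
move: 'C(n - 2, k - 2) 'C(n - 1, k - 1) 'C(n - 3, k - 3) 'C(n - 4, k - 4) 'C(n, k - 1)
  'C(n - k - 1, k - 1) => c C D E Cn M e1 e2 e3 e4 e5 hf h1 h2 pc.
have [q eq] : exists q, k = q + 3 by exists (k - 3); lia.
have [r er] : exists r, n = q + r + 3 by exists (n - k); move: hkn eq; clear; lia.
have k1 : k - 1 = q + 2 by lia.
have k2 : k - 2 = q + 1 by lia.
have k3 : k - 3 = q by lia.
have n1 : n - 1 = q + r + 2 by lia.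
have n2 : n - 2 = q + r + 1 by lia.
have n3 : n - 3 = q + r by lia.
have nk : n - (q + 2) = r + 1 by lia.
have q4 : 4 <= q by lia.
have hr : 2 * q ^ 2 + 10 * q + 10 <= r by move: hn; rewrite eq er; move: q4; clear; nia.
rewrite ?k1 ?k2 ?k3 ?n1 ?n2 ?n3 ?nk in e1 e2 e3 e4 h1 h2.
have g1 : k * (q + r + 2) * c <= k * (q + 2) * f + k * (q + 2) ^ 2 * c.
  have h : C + c <= f + k * c by lia.
  have := leq_mul (leqnn (k * (q + 2))) h; rewrite -[k * _ * c]mulnA e1 eq; lia.
have g2 : 2 * (q + 2) * Cn <= (2 * (q + r + 2) + (2 * k - 1)) * c.
  rewrite -(@leq_pmul2l (r + 1)) ?addn1 // -addn1.
  have -> : (r + 1) * (2 * (q + 2) * Cn) = 2 * (q + 2) * ((r + 1) * Cn) by lia.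
  have -> : 2 * (q + 2) * ((r + 1) * Cn) = 2 * n * ((q + r + 2) * c) by rewrite e4 e1; lia.
  rewrite [in leqLHS]mulnA.
  have h : 2 * n * (q + r + 2) <= (r + 1) * (2 * (q + r + 2) + (2 * k - 1)).
    by rewrite eq er (_ : 2 * (q + 3) - 1 = 2 * q + 5); [move: hr; clear; lia | lia].
  by have := leq_mul h (leqnn c); lia.
have g3 : n * (q + r + 2) * D <= ((q + r + 2) * (q + 1) + (2 * k - 3)) * c.
  rewrite -(@leq_pmul2l (q + r + 1)) ?addn1 // -addn1.
  have -> : (q + r + 1) * (n * (q + r + 2) * D) = n * (q + r + 2) * ((q + r + 1) * D) by lia.
  have -> : n * (q + r + 2) * ((q + r + 1) * D) = n * (q + r + 2) * (q + 1) * c.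
    by rewrite e2; lia.
  have h : n * (q + r + 2) * (q + 1) <= (q + r + 1) * ((q + r + 2) * (q + 1) + (2 * k - 3)).
    by rewrite eq er (_ : 2 * (q + 3) - 3 = 2 * q + 3); [move: hr; clear; lia | lia].
  by have := leq_mul h (leqnn c); lia.
(* In the sum of [g1], [g2], [g3] and the two hypotheses the terms [(n - 1) * c] cancel, because
   [k = 2 + (k - 2)]; only multiples of [c] free of [n] remain. *)
have g4 : Q * D <= Q * (2 * k * E) + (k * (k - 1) ^ 2 + 4 * k - 4) * c.
  rewrite k1 (_ : k * (q + 2) ^ 2 + 4 * k - 4 = k * (q + 2) ^ 2 + (2 * k - 1) + (2 * k - 3)).
    by move: g1 g2 g3 h1 h2; move: (2 * k - 1) (2 * k - 3) => u v; rewrite eq; lia.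
  by rewrite eq; lia.
have g5 : Q * ((k - 2) * (n - 3 - 2 * k * (k - 3))) <= (n - 2) * (n - 3) * (k * (k - 1) ^ 2 + 4 * k - 4).
  move: g4; move: (k * _ + _ - 4) => B g4.
  rewrite k2 k3 n2 n3 !mulnBr leq_subLR -(leq_pmul2r pc).
  have := leq_mul (leqnn ((q + r + 1) * (q + r))) g4.
  have -> : (q + r + 1) * (q + r) * (Q * D) = Q * (q + r) * ((q + r + 1) * D) by lia.
  rewrite [in X in X -> _]e2.
  have -> : (q + r + 1) * (q + r) * (Q * (2 * k * E) + B * c)
    = Q * (2 * k) * (q + r + 1) * ((q + r) * E) + (q + r + 1) * (q + r) * B * c by lia.
  rewrite e3.
  have -> : Q * (2 * k) * (q + r + 1) * (q * D) = Q * (2 * k) * q * ((q + r + 1) * D) by lia.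
  by rewrite e2; lia.
have H := nonheavy_poly n k hk hn.
have p : 0 < (k - 2) * (n - 3 - 2 * k * (k - 3)).
  rewrite muln_gt0 k2 k3 n3 addn1 /= subn_gt0 eq; move: hr; clear; lia.
rewrite -(leq_pmul2r p); apply: leq_trans H; rewrite -mulnA leq_mul2l.
by rewrite g5.
Qed.

Lemma leq_bin_id (m r : nat) : 0 < r -> r < m -> m <= 'C(m, r).
Proof.
move=> r0; elim: m => // m IH; rewrite ltnS leq_eqVlt => /orP[/eqP <-|ltrm].
  by rewrite binSn.
rewrite -(prednK r0) binS (prednK r0) -addn1 leq_add ?IH // bin_gt0.
by apply: leq_trans (leq_pred _) (ltnW ltrm).
Qed.

(** With [a = n - 1], this reduces bounds on the members missing the center to powers, by
    [bin_ratio] and the identity relating ['C(a, k - 1)] to ['C(a - 1, k - 2)]. *)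
Lemma bin_small_arith (a i k j : nat) : 1 < k -> 0 < a -> i <= a ->
  2 * (a + 1) * i ^ (k - 1) <= j * (k - 1) * a ^ (k - 2) ->
  2 * (a + 1) * 'C(i, k - 1) <= j * 'C(a - 1, k - 2).
Proof.
move=> k1 a0 ia h; have k0 : 0 < k - 1 by rewrite subn_gt0.
have hd : a * 'C(a - 1, k - 2) = (k - 1) * 'C(a, k - 1).
  by rewrite -bin_diag //; congr (_ * 'C(_, _)); rewrite -subnDA.
have hr := bin_ratio i a (k - 1) ia.
have p : 0 < (k - 1) * a ^ (k - 1) by rewrite muln_gt0 k0 expn_gt0 a0.
rewrite -(leq_pmul2l p).
have e : a ^ (k - 1) = a * a ^ (k - 2) by rewrite -expnS; congr (_ ^ _); move: k1; clear; lia.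
have H1 := leq_mul (leqnn (2 * (a + 1) * (k - 1))) hr.
have H2 := leq_mul h (leqnn (a * 'C(a - 1, k - 2))).
move: H1 H2; rewrite e; rewrite e in hr p *.
move: hd; clear; move: (k - 1) 'C(a - 1, k - 2) 'C(a, _) 'C(i, _) (a ^ (k - 2)) (i ^ _).
move=> q c d u v w hd H1 H2.
have E : 2 * (a + 1) * q * (w * d) = 2 * (a + 1) * w * (q * d) by lia.
rewrite E -hd in H1.
lia.
Qed.

(* [k ^ 3 <= 58 (k - 1) 4 ^ (k - 7)] is nearly tight at [k = 7]; the rest of the 69 absorbs [(a + 1) / a]. *)
Lemma cube_bound (a k : nat) : 7 <= k -> 100 <= a ->
  (a + 1) * k ^ 3 <= 69 * ((k - 1) * 4 ^ (k - 7)) * a.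
Proof.
move=> hk ha; have h : k ^ 3 <= 58 * ((k - 1) * 4 ^ (k - 7)).
  have [e ->] : exists e, k = e + 7 by exists (k - 7); move: hk; clear; lia.
  rewrite addnK; elim: e => [//|e IH].
  have -> : e.+1 + 7 - 1 = e + 7 by lia.
  have {}IH : (e + 7) ^ 3 <= 58 * ((e + 6) * 4 ^ e) by move: IH; have -> : e + 7 - 1 = e + 6 by lia.
  have h1 : (e.+1 + 7) ^ 3 <= 4 * (e + 7) ^ 3.
    rewrite [leqRHS](_ : _ = (e.+1 + 7) ^ 3 + (3 * e ^ 3 + 60 * e ^ 2 + 396 * e + 860)).
      exact: leq_addr.
    by clear; lia.
  apply: leq_trans h1 _; rewrite [4 ^ _]expnS.
  by move: IH; move: (4 ^ e) ((e + 7) ^ 3) => u v; clear; nia.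
have h2 : 58 * (a + 1) <= 69 * a by move: ha; clear; lia.
have := leq_mul h (leqnn (a + 1)); have := leq_mul h2 (leqnn ((k - 1) * 4 ^ (k - 7))).
by move: (k ^ 3) ((k - 1) * _) => u v; clear; lia.
Qed.

(** All but six factors [i] are replaced by [a / 4]; [cube_bound] absorbs the powers of 4. *)
Lemma pow_small_arith (a i k j : nat) : 7 <= k -> 100 <= a -> 4 * i <= a ->
  2 * (69 * i ^ 6) <= j * k ^ 3 * a ^ 4 ->
  2 * (a + 1) * i ^ (k - 1) <= j * (k - 1) * a ^ (k - 2).
Proof.
move=> hk ha hi h; have hc := cube_bound a k hk ha.
have -> : k - 1 = 6 + (k - 7) by move: hk; clear; lia.
have -> : k - 2 = 5 + (k - 7) by move: hk; clear; lia.
have he : 4 ^ (k - 7) * i ^ (k - 7) <= a ^ (k - 7).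
  by rewrite -expnMn; case: (k - 7) => // e; rewrite leq_exp2r.
have k30 : 0 < 69 * k ^ 3 by rewrite muln_gt0 expn_gt0 (leq_trans _ hk).
have p4 : 0 < 4 ^ (k - 7) by rewrite expn_gt0.
rewrite !expnD -(leq_pmul2l k30) -(leq_pmul2l p4).
have H := leq_mul (leq_mul h hc) he.
have -> : a ^ 5 = a * a ^ 4 by rewrite -expnS.
have -> : 6 + (k - 7) = k - 1 by move: hk; clear; lia.
move: H; clear; move: (k - 1) (k ^ 3) (4 ^ (k - 7)) (i ^ (k - 7)) (a ^ (k - 7)) (i ^ 6) (a ^ 4).
move=> q K F I A s t H; lia.
Qed.

(** [i] is the number of detached points; the right side is what [3 * k] of them cost in
    [split_arith]. *)
Lemma detached_arith (n k i : nat) : 7 <= k -> 12 * k ^ 2 <= n -> 4 * i <= 11 * k ^ 2 ->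
  2 * n * 'C(i, k - 1) <= 3 * k * 'C(n - 2, k - 2).
Proof.
move=> hk hn hi; have K49 : 7 ^ 2 <= k ^ 2 by rewrite leq_exp2r.
have n0 : 0 < n by move: hn K49; clear; lia.
have ha : 12 * k ^ 2 <= n - 1 + 1 by rewrite subnK.
have -> : n - 2 = n - 1 - 1 by rewrite -subnDA.
rewrite -[in 2 * n](subnK n0); move: (n - 1) ha => a ha; clear hn n0.
have k1 : 1 < k by apply: leq_trans hk.
have a100 : 100 <= a by move: ha K49; clear; lia.
(* 11/48, the ratio of the bounds on [i] and [n], is slightly below 3/13. Of the six factors [i],
   two are bounded through [k ^ 2] and four through [a]. *)
have h13 : 13 * i <= 3 * a by move: hi ha K49; clear; lia.
apply: bin_small_arith => //; [by apply: leq_trans a100 | by move: h13; clear; lia|].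
apply: pow_small_arith => //; first by move: h13; clear; lia.
have h2 : 16 * i ^ 2 <= 121 * k ^ 4.
  have := leq_mul hi hi; rewrite (_ : k ^ 4 = k ^ 2 * k ^ 2); first by clear; lia.
  by rewrite -expnD.
have h4 : 13 ^ 4 * i ^ 4 <= 3 ^ 4 * a ^ 4 by rewrite -!expnMn leq_exp2r.
have H := leq_mul h2 h4.
have -> : i ^ 6 = i ^ 2 * i ^ 4 by rewrite -expnD.
have -> : 3 * k * k ^ 3 = 3 * k ^ 4 by rewrite -mulnA -expnS.
have -> : 3 * k ^ 4 * a ^ 4 = 3 * (k ^ 4 * a ^ 4) by rewrite mulnA.
have {}H : 16 * 13 ^ 4 * (i ^ 2 * i ^ 4) <= 121 * 3 ^ 4 * (k ^ 4 * a ^ 4).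
  by rewrite mulnACA [leqRHS]mulnACA.
move: H; move: (i ^ 2 * i ^ 4) (k ^ 4 * a ^ 4) => u v; clear; lia.
Qed.

(** With few detached points, the cost of a single one suffices. *)
Lemma detached_arith_small (n k i : nat) : 7 <= k -> 12 * k ^ 2 <= n -> i <= 4 * k ->
  2 * n * 'C(i, k - 1) <= 'C(n - 2, k - 2).
Proof.
move=> hk hn hi; have K49 : 7 * k <= k ^ 2 by rewrite -mulnn leq_mul2r hk orbT.
have n0 : 0 < n by move: hk hn K49; clear; lia.
have ha : 12 * k ^ 2 <= n - 1 + 1 by rewrite subnK.
have -> : n - 2 = n - 1 - 1 by rewrite -subnDA.
rewrite -[in 2 * n](subnK n0) -['C(_ - 1, _)]mul1n; move: (n - 1) ha => a ha; clear hn n0.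
have k1 : 1 < k by apply: leq_trans hk.
have a100 : 100 <= a by move: hk ha K49; clear; lia.
have h20 : 20 * i <= a by move: hi ha K49 hk; clear; lia.
apply: bin_small_arith => //; [by apply: leq_trans a100 | by move: h20; clear; lia|].
apply: pow_small_arith => //; first by move: h20; clear; lia.
have h2 : i ^ 2 <= 16 * k ^ 2 by have := leq_mul hi hi; clear; lia.
have h3 : k ^ 2 <= k ^ 3 by rewrite leq_pexp2l // (leq_trans _ hk).
have h4 : 20 ^ 4 * i ^ 4 <= a ^ 4 by rewrite -expnMn leq_exp2r.
have H := leq_mul (leq_trans h2 (leq_mul (leqnn 16) h3)) h4.
have -> : i ^ 6 = i ^ 2 * i ^ 4 by rewrite -expnD.
have {}H : 20 ^ 4 * (i ^ 2 * i ^ 4) <= 16 * (k ^ 3 * a ^ 4).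
  by rewrite mulnCA [leqRHS]mulnA.
move: H; rewrite mul1n; move: (i ^ 2 * i ^ 4) (k ^ 3 * a ^ 4) => u v; clear; lia.
Qed.

(** Excluding [j] more points lowers the first binomial by at least [j * e], where [e] is
    ['C(n - 1 - (k + j), k - 2)]. Twice [e] is at least ['C(n - 2, k - 2) + 4 * k * 'C(n - 3, k -
    3)]: the first term pays for [f0], the second for the members through the [j] points. *)
Lemma split_arith (n k j f0 f1 : nat) : 7 <= k -> 12 * k ^ 2 <= n -> j <= 3 * k ->
  2 * f0 <= j * 'C(n - 2, k - 2) ->
  f1 <= 'C(n - 1 - (k + j), k - 1) + 'C(n - 2, k - 2) + j * (2 * k * 'C(n - 3, k - 3)) ->
  f0 + f1 <= 'C(n - k - 1, k - 1) + 'C(n - 2, k - 2).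
Proof.
move=> hk hn hj h0 h1.
have hK : 7 * k <= k ^ 2 by rewrite -mulnn leq_mul2r hk orbT.
have hd : (n - 2) * 'C(n - 3, k - 3) = (k - 2) * 'C(n - 2, k - 2).
  have k0 : 0 < k - 2 by move: hk; clear; lia.
  have n0 : 0 < n - 2 by move: hk hn hK; clear; lia.
  by have := bin_diag (n - 2) (k - 2) k0 n0; rewrite -!subnDA.
have hD : 12 * k * 'C(n - 3, k - 3) <= 'C(n - 2, k - 2).
  have p : 0 < n - 2 by rewrite subn_gt0; move: hk hn hK; clear; lia.
  rewrite -(leq_pmul2l p) mulnCA hd mulnA leq_mul2r; apply/orP; right.
  by rewrite mulnBr leq_subLR; move: hn hK hk; clear; lia.
have hA := bin_add_ge (n - 1 - (k + j)) j (k - 2).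
have hB := bin_add_le (n - 1 - (k + j)) (k - 1 + j) (k - 3).
have n1 : n - 1 - (k + j) + j = n - k - 1 by move: hn hK hk hj; clear; lia.
have n2 : n - 1 - (k + j) + (k - 1 + j) = n - 2 by move: hn hK hk hj; clear; lia.
have n3 : n - 2 - 1 = n - 3 by rewrite -subnDA.
have k1 : (k - 2).+1 = k - 1 by move: hk; clear; lia.
have k2 : (k - 3).+1 = k - 2 by move: hk; clear; lia.
rewrite n1 k1 in hA; rewrite n2 n3 k2 in hB.
move: hk hj h0 h1 hD hA hB; clear.
move: 'C(n - 2, k - 2) 'C(n - 3, k - 3) 'C(n - 1 - (k + j), k - 2) 'C(n - 1 - (k + j), k - 1).
move: 'C(n - k - 1, k - 1) => M c D e g hk hj h0 h1 hD hA hB.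
have h2 : (k - 1 + j) * D <= 4 * k * D by rewrite leq_mul2r; apply/orP; right; lia.
have h3 : c + 4 * (k * D) <= 2 * e by lia.
have := leq_mul (leqnn j) h3; rewrite mulnDr; lia.
Qed.

Lemma sunflower_arith (n k : nat) : 7 <= k -> 12 * k ^ 2 <= n ->
  n + 'C(n - k, k - 1) + 'C(n - 3, k - 3)
    <= 'C(n - k - 1, k - 1) + 'C(n - 2, k - 2) + 2 * 'C(n - k - 2, k - 3).
Proof.
move=> hk hn.
have hK : 7 * k <= k ^ 2 by rewrite -mulnn leq_mul2r hk orbT.
have e1 : 'C(n - k, k - 1) = 'C(n - k - 1, k - 1) + 'C(n - k - 1, k - 2).
  have := binS (n - k - 1) (k - 2).
  have -> : (n - k - 1).+1 = n - k by move: hn hk hK; clear; lia.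
  by have -> : (k - 2).+1 = k - 1 by move: hk; clear; lia.
have e2 : 'C(n - 3, k - 3) + 'C(n - 3, k - 2) = 'C(n - 2, k - 2).
  have := binS (n - 3) (k - 3).
  have -> : (n - 3).+1 = n - 2 by move: hn hk hK; clear; lia.
  have -> : (k - 3).+1 = k - 2 by move: hk; clear; lia.
  by rewrite addnC => ->.
have e3 : 'C(n - k - 1, k - 2) <= 'C(n - 3, k - 2) by apply: leq_bin2l; move: hk; clear; lia.
have e4 : n - k - 2 <= 'C(n - k - 2, k - 3) by apply: leq_bin_id; move: hk hn hK; clear; lia.
have e5 : n <= 2 * (n - k - 2) by move: hk hn hK; clear; lia.
by lia.
Qed.

(** * The center *)

Definition nonheavy {T : finType} (k : nat) (F : {set {set T}}) (x : T) : {set T} :=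
  [set y | (y != x) && ~~ heavy k F x y].

(* This holds when [{c, y}] is good, but also with [P] a line through [y] and [c], whose third point may be impossible to avoid. *)
Definition attached {T : finType} (k : nat) (F : {set {set T}}) (c y : T) : bool :=
  (y != c) && [exists P : {set T}, [&& good k F P, #|P| <= k, c \in P, y \in P
    & [forall A in F, (y \in A) ==> (c \in A) || (A :&: P == [set y])]]].

(** The set I of the header. *)
Definition detached {T : finType} (k : nat) (F : {set {set T}}) (c : T) : {set T} :=
  [set y | (y != c) && ~~ attached k F c y].

Lemma attachedP {T : finType} (k : nat) (F : {set {set T}}) (c y : T) :
  attached k F c y -> exists P : {set T}, [/\ good k F P, #|P| <= k, c \in P, y \in P
    & forall A, A \in F -> y \in A -> c \notin A -> A :&: P = [set y]].
Proof.
case/andP=> _ /existsP[P /and5P[gP cP cinP yP /forall_inP h]]; exists P; split=> // A AF yA cA.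
by have := h A AF; rewrite yA (negbTE cA) => /eqP.
Qed.

(** A member through [y] that misses [c] also misses [x], so its trace on the good triple is
    [[set y]]. *)
Lemma line_attached {T : finType} (k : nat) (F : {set {set T}}) (x y c : T) :
  uniform k F -> 3 <= k -> line k F x y c -> attached k F c y.
Proof.
move=> uF k3 l; have [nxy ncx ncy clo _] := l.
rewrite /attached eq_sym ncy; apply/existsP; exists [set x; y; c].
rewrite (good_line k F x y c uF l) cards3 // k3 !inE !eqxx !orbT /=.
apply/forall_inP=> A AF; apply/implyP=> yA; have [//|cA] := boolP (c \in A).
apply/eqP/setP=> v; rewrite !inE.
have xA : x \notin A by apply: contra cA => xA; apply: clo.
have [->|nvy] := eqVneq v y; first by rewrite yA orbT.
rewrite orbF; apply/negP=> /andP[vA /orP[]/eqP e]; first by rewrite -e vA in xA.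
by rewrite -e vA in cA.
Qed.

Lemma sum_nonheavy {T : finType} (k : nat) (F : {set {set T}}) :
  uniform k F -> 2 * (k - 2) ^ 2 <= #|T| - 2 ->
  \sum_x \sum_(y | y != x) #|nkpair F x y| + (\sum_x #|nonheavy k F x|) * 'C(#|T| - 3, k - 3)
    <= #|T| * (#|T| - 1) * 'C(#|T| - 3, k - 3)
       + (\sum_x #|nonheavy k F x|) * (2 * k * 'C(#|T| - 4, k - 4)).
Proof.
move=> uF hn; set D := 'C(#|T| - 3, _); set E := 2 * k * _.
have -> : #|T| * (#|T| - 1) * D = \sum_(x : T) \sum_(y | y != x) D.
  rewrite -mulnA -[#|T|]/(#|xpredT : pred T|) -sum_nat_const; apply: eq_bigr => x _.
  rewrite sum_nat_const; congr (_ * _).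
  by rewrite -cardsE cardsT; have := cardC1 x; rewrite subn1 => <-.
rewrite !big_distrl -!big_split /=; apply: leq_sum => x _.
have e m : #|nonheavy k F x| * m = \sum_(y | y != x) (~~ heavy k F x y) * m.
  rewrite -big_distrl /=; congr (_ * _); rewrite -sum1_card big_mkcond [RHS]big_mkcond /=.
  by apply: eq_bigr => y _; rewrite inE; case: (y != x).
rewrite !e -!big_split /=; apply: leq_sum => y nyx.
have := card_nkpair k F x y uF _ hn; rewrite eq_sym => /(_ nyx).
by case: ifP => _ /=; rewrite ?mul0n ?mul1n ?addn0 // addnC leq_add2l.
Qed.

(** Choose [x0] with fewest non-heavy partners, then [y0] with fewest among the heavy partners of
    [x0], and let [c] be z(x0,y0). By [line_triangle], a point other than [c] that is heavy with
    both is attached to [c]. Averaging gives at most 5k^2/4 and 6k^2/4 exceptions. *)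
Lemma exists_center {T : finType} (k : nat) (F : {set {set T}}) :
  uniform k F -> helly3 F -> 7 <= k -> 12 * k ^ 2 <= #|T| ->
  'C(#|T| - k - 1, k - 1) + 'C(#|T| - 2, k - 2) <= #|F| ->
  exists c, 4 * #|detached k F c| <= 11 * k ^ 2.
Proof.
move=> uF hF hk hn hcard; set n := #|T| in hn hcard *.
have k3 : 3 <= k by apply: leq_trans hk.
have hn2 : 2 * (k - 2) ^ 2 <= n - 2 by move: hk hn; clear; nia.
pose nh x := #|nonheavy k F x|; pose Q := \sum_x nh x.
have hQ : 4 * Q <= 5 * k ^ 2 * n.
  apply: nonheavy_arith hk hn hcard (global_count k F uF hF k3) _.
  exact: sum_nonheavy.
have [x1 _] : exists x : T, x \in T.
  by apply/card_gt0P; rewrite -/n; apply: leq_trans hn; rewrite muln_gt0 expn_gt0 (leq_trans _ hk).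
case: (@arg_minnP _ x1 xpredT nh isT) => x0 _ min0.
have h0 : 4 * nh x0 <= 5 * k ^ 2.
  have : n * nh x0 <= Q.
    by rewrite -[n]/(#|xpredT : pred T|) -sum_nat_const leq_sum // => x _; apply: min0.
  by move: hQ hn hk; move: (nh x0) => a; clear; nia.
pose N := [set y | (y != x0) && heavy k F x0 y].
have cN : #|N| + nh x0 + 1 = n.
  rewrite -addnA addn1; have := cardsC1 x0; rewrite -/n => c1.
  have n0 : 0 < n by apply: leq_trans hn; rewrite muln_gt0 expn_gt0 (leq_trans _ hk).
  rewrite addnS -(prednK n0) -c1 -(cardsID [set y | heavy k F x0 y] [set~ x0]).
  by congr ((_ + _).+1); apply: eq_card => y; rewrite !inE // andbC.
have [y1 y1N] : exists y, y \in N.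
  by apply/card_gt0P; move: cN h0 hn hk; clear; nia.
case: (@arg_minnP _ y1 (mem N) nh y1N) => y0 y0N min1.
have h1 : 4 * nh y0 <= 6 * k ^ 2.
  have : #|N| * nh y0 <= Q.
    rewrite -sum_nat_const /Q [leqRHS](bigID (mem N)) /=; apply: leq_trans (leq_addr _ _).
    by apply: leq_sum => y; apply: min1.
  have K49 : 7 ^ 2 <= k ^ 2 by rewrite leq_exp2r.
  move: hQ hn K49 cN h0; move: (nh y0) (nh x0) #|N| (k ^ 2) => a b m K; clear.
  move=> hQ hn K49 cN h0 hm; rewrite leqNgt; apply/negP=> ha.
  (* This contradicts that [x0] has at most 5k^2/4, hence at most 5n/48, non-heavy partners. *)
  have : m * 6 <= 5 * n.
    rewrite -(@leq_pmul2l K); last by apply: leq_trans K49.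
    by have := leq_mul (leqnn m) (ltnW ha); lia.
  by lia.
have : y0 \in N by []; rewrite inE => /andP[ny0x0 hv0].
have nx0y0 : x0 != y0 by rewrite eq_sym.
have [c lc] := heavy_line k F x0 y0 uF nx0y0 hn2 hv0.
exists c; suff : #|detached k F c| <= nh x0 + nh y0 by move: h0 h1; clear; lia.
apply: leq_trans (subset_leq_card _) (leq_card_setU _ _).
apply/subsetP=> y; rewrite /detached /nonheavy !inE => /andP[nyc].
apply: contraR; rewrite negb_or !negb_and !negbK => /andP[].
have [-> _ _|nyx0 /= hx] := eqVneq y x0; first exact: (line_attached _ _ y0) (line_sym _ _ _ _ _ lc).
have [-> _|nyy0 /= hy] := eqVneq y y0; first exact: (line_attached _ _ x0).
have [z' l'] : exists z, line k F x0 y z by apply: heavy_line => //; rewrite eq_sym.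
have [u l''] : exists z, line k F y0 y z by apply: heavy_line => //; rewrite eq_sym.
apply: (line_attached _ _ x0) => //.
by rewrite -(line_triangle k F x0 y0 y c z' u) // (leq_trans _ hk).
Qed.

(** * Members through and off the center *)

(** The good set [P] attaching [x] meets [A] in [c] and [B] in [x] alone, so the point common to
    [P], [A] and [B] is [x]. *)
Lemma attached_mem {T : finType} (k : nat) (F : {set {set T}}) (c x : T) (A B : {set T}) :
  uniform k F -> helly3 F -> attached k F c x -> B \in F -> c \notin B -> x \in B ->
  A \in F -> c \in A -> A :&: B != set0 -> x \in A.
Proof.
move=> uF hF /attachedP[P [gP cP cinP xP hP]] BF cB xB AF cA nAB.
have : P :&: A :&: B != set0.
  apply: (good_helly3 k F) => //; try exact: good_mem; try by rewrite (uF _ _).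
  - by apply/set0Pn; exists c; rewrite inE cinP.
  - by apply/set0Pn; exists x; rewrite inE xP.
case/set0Pn=> v; rewrite !inE => /andP[/andP[vP vA] vB].
by have /setP/(_ v) := hP B BF xB cB; rewrite !inE vB vP => /esym/eqP <-.
Qed.

(** The sets attaching [x] and [x'] share [c], and both meet [B]; the point common to all three is
    [x] as well as [x']. *)
Lemma attached_uniq {T : finType} (k : nat) (F : {set {set T}}) (c x x' : T) (B : {set T}) :
  uniform k F -> helly3 F -> attached k F c x -> attached k F c x' ->
  B \in F -> c \notin B -> x \in B -> x' \in B -> x = x'.
Proof.
move=> uF hF /attachedP[P [gP cP cinP xP hP]] /attachedP[P' [gP' cP' cinP' xP' hP']].
move=> BF cB xB xB'.
have : P :&: P' :&: B != set0.
  apply: (good_helly3 k F) => //; try exact: good_mem; try by rewrite (uF _ _).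
  - by apply/set0Pn; exists c; rewrite inE cinP.
  - by apply/set0Pn; exists x; rewrite inE xP.
  - by apply/set0Pn; exists x'; rewrite inE xP'.
case/set0Pn=> v; rewrite !inE => /andP[/andP[vP vP'] vB].
have /setP/(_ v) := hP B BF xB cB; rewrite !inE vB vP => /esym/eqP <-.
by have /setP/(_ v) := hP' B BF xB' cB; rewrite !inE vB vP' => /esym/eqP <-.
Qed.

Lemma card_inter_detached {T : finType} (k : nat) (F : {set {set T}}) (c : T) (B : {set T}) :
  uniform k F -> helly3 F -> B \in F -> c \notin B -> k - 1 <= #|B :&: detached k F c|.
Proof.
move=> uF hF BF cB; have eB := cardsID (detached k F c) B.
rewrite leq_subLR -[leqLHS](uF B BF) -eB addnC leq_add2r leqNgt; apply/negP=> /card_gt1P[x [x' [xD xD' /eqP]]]; apply.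
have att v : v \in B :\: detached k F c -> v \in B /\ attached k F c v.
  rewrite !inE negb_and !negbK => /andP[/orP[/eqP->|->] vB] //.
  by rewrite vB in cB.
have [[xB xa] [xB' xa']] := (att x xD, att x' xD').
exact: (attached_uniq k F c x x' B).
Qed.

(** Were [[set c; x]] good, it would itself attach [x] to [c]. *)
Lemma card_detached_pair {T : finType} (k : nat) (F : {set {set T}}) (c x : T) :
  uniform k F -> 2 <= k -> x \in detached k F c ->
  #|up F [set c; x]| <= 2 * k * 'C(#|T| - 3, k - 3).
Proof.
move=> uF k2; rewrite inE => /andP[nxc]; rewrite /attached nxc /= => /existsPn/(_ [set c; x]).
have c2 : #|[set c; x]| = 2 by rewrite cards2 eq_sym nxc.
rewrite c2 k2 !inE !eqxx orbT /= andbC => h.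
have /(not_good_card k F _ uF) : ~~ good k F [set c; x].
  apply: contra h => ->; rewrite andbT; apply/forall_inP=> A AF; apply/implyP=> xA.
  have [//|cA] := boolP (c \in A); apply/eqP/setP=> v; rewrite !inE.
  have [->|_] := eqVneq v c; first by rewrite (negbTE cA) eq_sym (negbTE nxc).
  by have [->|_] := eqVneq v x; rewrite ?xA // andbF.
by rewrite c2.
Qed.

(** Two members through [c] that meet [B] share with it a point, which is not [c]. So
    [intersecting_over] applies above [[set c]], and both of its alternatives respect the bound. *)
Lemma card_meeting {T : finType} (k : nat) (F : {set {set T}}) (c : T) (B : {set T}) :
  uniform k F -> helly3 F -> 7 <= k -> 12 * k ^ 2 <= #|T| -> B \in F -> c \notin B ->
  #|[set A in F | (c \in A) && (A :&: B != set0)]| <= 'C(#|T| - 2, k - 2).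
Proof.
move=> uF hF hk hn BF cB; set G := [set A in F | _].
have GE A : A \in G -> [/\ A \in F, c \in A & A :&: B != set0].
  by rewrite inE => /and3P[].
have uG : uniform k G by move=> A /GE[/uF].
case: (intersecting_over k G [set c] uG).
- by move=> A /GE[_ cA _]; rewrite sub1set.
- move=> A A' /GE[AF cA nA] /GE[A'F cA' nA']; apply/eqP=> e.
  have : A :&: A' :&: B != set0 by apply: hF => //; apply/set0Pn; exists c; rewrite inE cA.
  by rewrite e => /set0Pn[v]; rewrite !inE => /andP[/eqP->]; apply/negP.
- by rewrite cards1; move: hk hn; clear; nia.
- case=> z; rewrite inE => nzc zG.
  have c2 : #|[set c; z]| = 2 by rewrite cards2 eq_sym nzc.
  rewrite -c2; apply: leq_trans (card_up k F [set c; z] uF).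
  apply/subset_leq_card/subsetP=> A AG; have [AF cA _] := GE A AG.
  by rewrite inE AF subUset !sub1set cA zG.
rewrite cards1 -!subnDA => h; apply: leq_trans h _.
have hK : 7 * k <= k ^ 2 by rewrite -mulnn leq_mul2r hk orbT.
have k0 : 0 < k - 2 by move: hk; clear; lia.
have n0 : 0 < #|T| - 2 by move: hn hk hK; clear; lia.
have := bin_diag (#|T| - 2) (k - 2) k0 n0; rewrite -!subnDA => hd.
rewrite -(leq_pmul2l n0) mulnCA hd mulnA leq_mul2r; apply/orP; right.
rewrite -mulnA leq_subRL; move: hn hk; clear; nia.
Qed.

(** A member through [c] avoids both [B] and [J], or meets [B], or contains a detached point of
    [J]. *)
Lemma card_center {T : finType} (k : nat) (F : {set {set T}}) (c : T) (B J : {set T}) :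
  uniform k F -> helly3 F -> 7 <= k -> 12 * k ^ 2 <= #|T| -> B \in F -> c \notin B ->
  J \subset detached k F c -> [disjoint J & B] ->
  #|[set A in F | c \in A]| <= 'C(#|T| - 1 - (k + #|J|), k - 1) + 'C(#|T| - 2, k - 2)
     + #|J| * (2 * k * 'C(#|T| - 3, k - 3)).
Proof.
move=> uF hF hk hn BF cB sJ dJB.
have cJ : c \notin J.
  by apply/negP=> /(subsetP sJ); rewrite inE eqxx.
pose X := [set A : {set T} | [&& #|A| == k, [set c] \subset A & [disjoint A & B :|: J]]].
pose Y := [set A in F | (c \in A) && (A :&: B != set0)].
pose Z := \bigcup_(x in J) up F [set c; x].
have cX : #|X| = 'C(#|T| - 1 - (k + #|J|), k - 1).
  rewrite card_ksets_between ?cards1 //; last by apply: leq_trans hk.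
    rewrite cardsU (uF B BF); suff -> : B :&: J = set0 by rewrite cards0 subn0.
    by apply/eqP; rewrite setI_eq0 disjoint_sym.
  by rewrite disjoints1 inE negb_or cB.
have cZ : #|Z| <= #|J| * (2 * k * 'C(#|T| - 3, k - 3)).
  apply: card_bigcup_le => x xJ; apply: card_detached_pair => //; last exact: (subsetP sJ).
  by apply: leq_trans hk.
have cY := card_meeting k F c B uF hF hk hn BF cB.
apply: (@leq_trans #|X :|: Y :|: Z|); last first.
  apply: leq_trans (leq_card_setU _ _) (leq_add _ cZ).
  by apply: leq_trans (leq_card_setU _ _) _; rewrite cX leq_add2l.
apply/subset_leq_card/subsetP=> A; rewrite inE => /andP[AF cA].
rewrite !in_setU.
have [AZ|nZ] := boolP (A \in Z); first by apply/orP; right.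
have [AY|nY] := boolP (A \in Y); first by apply/orP; left; apply/orP; right.
apply/orP; left; apply/orP; left.
rewrite inE (uF A AF) eqxx sub1set cA /= -setI_eq0 setIUr setU_eq0.
move: nY; rewrite inE AF cA /= negbK => ->; rewrite /= setI_eq0 disjoint_sym.
apply/pred0P=> x /=; apply/negP=> /andP[xJ xA]; case/negP: nZ.
by apply/bigcupP; exists x => //; rewrite inE AF subUset !sub1set cA.
Qed.

(** A member missing [c] consists of [k - 1] detached points and one further point. *)
Lemma card_off_center {T : finType} (k : nat) (F : {set {set T}}) (c : T) :
  uniform k F -> helly3 F -> 0 < k ->
  #|[set A in F | c \notin A]| <= #|T| * 'C(#|detached k F c|, k - 1).
Proof.
move=> uF hF k0; set I := detached k F c.
pose S := [set A : {set T} | A \subset I & #|A| == k - 1].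
have -> : #|T| * 'C(#|I|, k - 1) = #|setX [set: T] S| by rewrite cardsX cardsT cards_draws.
apply: leq_trans (leq_imset_card (fun p => p.1 |: p.2) _).
apply/subset_leq_card/subsetP=> A; rewrite inE => /andP[AF cA].
have h : k - 1 <= #|A :&: I| := card_inter_detached k F c A uF hF AF cA.
have [B sB cB] : exists2 B : {set T}, B \subset A :&: I & #|B| = k - 1.
  have : 0 < 'C(#|A :&: I|, k - 1) by rewrite bin_gt0.
  rewrite -cards_draws => /card_gt0P[B]; rewrite inE => /andP[sB /eqP cB].
  by exists B.
move: sB; rewrite subsetI => /andP[sBA sBI].
have : 0 < #|A :\: B| by rewrite cardsDS // (uF A AF) cB subKn.
case/card_gt0P=> x; rewrite inE => /andP[xB xA].
apply/imsetP; exists (x, B); first by rewrite !inE sBI cB eqxx.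
apply/esym/eqP; rewrite eqEcard subUset sub1set xA sBA /= cardsU1 xB cB (uF A AF) add1n.
by rewrite subn1 prednK.
Qed.

Lemma card_sunflower_center {T : finType} (k : nat) (F : {set {set T}}) (c : T)
    (B B' : {set T}) :
  uniform k F -> helly3 F -> 3 <= k -> 3 <= #|T| -> B \in F -> B' \in F -> B != B' ->
  c \notin B -> c \notin B' -> #|detached k F c| = k - 1 ->
  #|[set A in F | c \in A]| + 2 * 'C(#|T| - k - 2, k - 3)
    <= 'C(#|T| - k, k - 1) + 'C(#|T| - 3, k - 3).
Proof.
move=> uF hF k3 n3 BF BF' nBB' cB cB' cI; set I := detached k F c in cI.
have core A : A \in F -> c \notin A -> exists x, [/\ A = x |: I, x \notin I & attached k F c x].
  move=> AF cA; have := card_inter_detached k F c A uF hF AF cA; rewrite -/I => h.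
  have sI : I \subset A by apply/setIidPr/eqP; rewrite eqEcard subsetIr cI.
  have : 0 < #|A :\: I| by rewrite cardsDS // (uF A AF) cI subKn // (leq_trans _ k3).
  case/card_gt0P=> x; rewrite inE => /andP[xI xA]; exists x; split=> //.
    apply/esym/eqP; rewrite eqEcard subUset sub1set xA sI cardsU1 xI cI (uF A AF) /=.
    by move: k3; clear; lia.
  move: xI; rewrite inE negb_and !negbK => /orP[/eqP e|//].
  by rewrite -e xA in cA.
have [x [eB xI xa]] := core B BF cB; have [x' [eB' xI' xa']] := core B' BF' cB'.
have nxx' : x != x' by apply: contra nBB' => /eqP e; rewrite eB eB' e.
have ncx : c != x by apply: contra cB => /eqP ->; rewrite eB setU11.
have ncx' : c != x' by apply: contra cB' => /eqP ->; rewrite eB' setU11.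
have cI' : c \notin I by rewrite inE eqxx.
pose U := [set A : {set T} | [&& #|A| == k, [set c] \subset A & [disjoint A & I]]].
pose Y := [set A : {set T} | (#|A| == k) && ([set c; x; x'] \subset A)].
have c3 : #|[set c; x; x']| = 3 by rewrite cards3 // eq_sym.
have cU : #|U| = 'C(#|T| - k, k - 1).
  rewrite card_ksets_between ?cards1 ?disjoints1 //; last by apply: leq_trans k3.
  by rewrite cI -subnDA subnKC // (leq_trans _ k3).
have cY : #|Y| = 'C(#|T| - 3, k - 3) by rewrite card_ksets_over c3.
have cUY : #|U :&: Y| = 'C(#|T| - k - 2, k - 3).
  have <- : #|T| - 3 - #|I| = #|T| - k - 2 by rewrite cI; move: k3; clear; lia.
  rewrite -c3 -card_ksets_between ?c3 //.
    apply: eq_card => A; rewrite !inE.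
    case: (_ == _) => //=; rewrite andbC; case s : ([set c; x; x'] \subset A) => //=.
    by move: s; rewrite !subUset => /andP[/andP[-> _] _].
  rewrite -setI_eq0 !setIUl !setU_eq0 !setI_eq0 !disjoints1 cI' xI.
  by rewrite xI'.
have : [set A in F | c \in A] \subset (U :\: Y) :|: (Y :\: U).
  apply/subsetP=> A; rewrite inE => /andP[AF cA].
  have UA : (A \in U) = [disjoint A & I] by rewrite inE (uF A AF) eqxx sub1set cA.
  have YA : (A \in Y) = (x \in A) && (x' \in A).
    by rewrite inE (uF A AF) eqxx !subUset !sub1set cA.
  rewrite !in_setU !in_setD UA YA; have [dA|nA] := boolP [disjoint A & I].
    rewrite /= orbF andbT; apply/negP=> /andP[xA xA'].
    have : B :&: B' :&: A != set0.
      apply: hF => //; apply/set0Pn.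
      - have : 0 < #|I| by rewrite cI subn_gt0 (leq_trans _ k3).
        by case/card_gt0P=> v vI; exists v; rewrite eB eB'; apply/setIP; split; apply/setU1P; right.
      - by exists x; rewrite eB; apply/setIP; split=> //; apply/setU1P; left.
      - by exists x'; rewrite eB'; apply/setIP; split=> //; apply/setU1P; left.
    case/set0Pn=> v; rewrite eB eB' !in_setI !in_setU1 => /andP[/andP[v1 v2] vA].
    have vI : v \notin I.
      apply/negP=> vI; have : v \in A :&: I by apply/setIP.
      by move: dA; rewrite -setI_eq0 => /eqP ->; rewrite in_set0.
    move: v1 v2; rewrite (negbTE vI) !orbF => /eqP-> e.
    by case/negP: nxx'.
  move: nA; rewrite -setI_eq0 => /set0Pn[v]; rewrite inE => /andP[vA vI] /=.
  apply/orP; right; apply/andP; split.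
    apply: (attached_mem k F c x A B) => //; first by rewrite eB setU11.
    by apply/set0Pn; exists v; rewrite eB; apply/setIP; split=> //; apply/setU1P; right.
  apply: (attached_mem k F c x' A B') => //; first by rewrite eB' setU11.
  by apply/set0Pn; exists v; rewrite eB'; apply/setIP; split=> //; apply/setU1P; right.
move/subset_leq_card=> /leq_trans/(_ (leq_card_setU _ _)) h.
have eU := cardsID Y U; have eY := cardsID U Y.
rewrite setIC cUY cY in eY; rewrite cUY cU in eU; rewrite -eU -eY.
by rewrite addnACA addnn -mul2n addnC leq_add2l.
Qed.

(** If at most one member misses [c], [card_center] with empty [J] is enough. Otherwise detached
    points outside a member missing [c] must outweigh the members missing [c]: [3 * k] points if
    there are at least [4 * k] detached ones, one point if there are fewer. Exactly [k - 1] detached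
    points is the sunflower case. *)
Lemma card_nontrivial_helly3 {T : finType} (k : nat) (F : {set {set T}}) :
  uniform k F -> helly3 F -> 7 <= k -> 12 * k ^ 2 <= #|T| ->
  (forall c, exists2 A, A \in F & c \notin A) ->
  #|F| <= 1 + 'C(#|T| - k - 1, k - 1) + 'C(#|T| - 2, k - 2).
Proof.
move=> uF hF hk hn ntF; rewrite leqNgt; apply/negP=> big.
have [c cI] : exists c, 4 * #|detached k F c| <= 11 * k ^ 2.
  by apply: exists_center => //; apply: leq_trans (ltnW big); rewrite leq_add2r leq_addl.
move: big; apply/negP; rewrite -leqNgt.
pose F0 := [set A in F | c \notin A]; pose F1 := [set A in F | c \in A].
have -> : #|F| = #|F0| + #|F1|.
  rewrite addnC -(cardsID F1 F); congr (_ + _); apply: eq_card => A; rewrite !inE.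
    by case: (A \in F).
  by case: (A \in F); rewrite /= ?andbT ?andbF.
have [B BF cB] := ntF c.
have hd : forall (B J : {set T}), B \in F -> c \notin B -> J \subset detached k F c ->
    [disjoint J & B] -> #|J| <= 3 * k -> 2 * #|F0| <= #|J| * 'C(#|T| - 2, k - 2) ->
    #|F0| + #|F1| <= 1 + 'C(#|T| - k - 1, k - 1) + 'C(#|T| - 2, k - 2).
  move=> B1 J B1F cB1 sJ dJ cJ h; rewrite -addnA; apply: leq_trans (leq_addl 1 _).
  apply: (split_arith _ _ _ _ _ hk hn cJ h); exact: (card_center k F c B1 J uF hF hk hn B1F cB1 sJ dJ).
have [le1|gt1] := leqP #|F0| 1.
  have := card_center k F c B set0 uF hF hk hn BF cB (sub0set _).
  rewrite -setI_eq0 set0I eqxx cards0 addn0 mul0n addn0 -!subnDA => /(_ isT).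
  by rewrite -/F1 [1 + k]addnC; move: le1; clear; lia.
have [B1 [B2 [B1F0 B2F0 nB12]]] := card_gt1P gt1.
have [B1F cB1] : B1 \in F /\ c \notin B1 by move: B1F0; rewrite inE => /andP.
have [B2F cB2] : B2 \in F /\ c \notin B2 by move: B2F0; rewrite inE => /andP.
have k0 : 0 < k by apply: leq_trans hk.
have c0 := card_off_center k F c uF hF k0; rewrite -/F0 in c0.
set I := detached k F c in cI c0 hd.
have : k - 1 <= #|I|.
  apply: leq_trans (card_inter_detached k F c B uF hF BF cB) _.
  by rewrite subset_leq_card ?subsetIr.
rewrite leq_eqVlt => /orP[/eqP eI|ltI].
  have n3 : 3 <= #|T| by apply: leq_trans hn; move: hk; clear; nia.
  have k3 : 3 <= k by apply: leq_trans hk.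
  have := card_sunflower_center k F c B1 B2 uF hF k3 n3 B1F B2F nB12 cB1 cB2 (esym eI).
  rewrite -/F1; move: c0; rewrite -eI binn muln1.
  by have := sunflower_arith #|T| k hk hn; clear; lia.
have [leI|gtI] := leqP (4 * k) #|I|.
  have [J sJ cJ] : exists2 J : {set T}, J \subset I :\: B & #|J| = 3 * k.
    have : 0 < 'C(#|I :\: B|, 3 * k).
      rewrite bin_gt0 cardsD; have := subset_leq_card (subsetIr I B).
      by rewrite (uF B BF); move: leI; clear; lia.
    rewrite -cards_draws => /card_gt0P[J]; rewrite inE => /andP[sJ /eqP cJ].
    by exists J.
  apply: (hd B J) => //.
  - exact: subset_trans sJ (subsetDl _ _).
  - exact: disjointWl sJ (disjoint_setDl _ _).
  - by rewrite cJ.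
  rewrite cJ; apply: leq_trans (detached_arith _ _ _ hk hn cI).
  by rewrite -mulnA leq_mul2l.
(* With at least [k] detached points, two distinct members of size [k] cannot both contain them
   all. *)
have [B3 [B3F cB3 /subsetPn[x xI xB3]]] :
    exists B3, [/\ B3 \in F, c \notin B3 & ~~ (I \subset B3)].
  have [s1|] := boolP (I \subset B1); last by exists B1.
  have [s2|] := boolP (I \subset B2); last by exists B2.
  have kI : k <= #|I| by move: ltI; rewrite subn1 prednK.
  case/eqP: nB12.
  have /eqP <- : I == B1 by rewrite eqEcard s1 (uF B1 B1F).
  by apply/eqP; rewrite eqEcard s2 (uF B2 B2F).
apply: (hd B3 [set x]) => //; rewrite ?sub1set ?disjoints1 ?cards1 //.
  by rewrite muln_gt0.
rewrite mul1n; apply: leq_trans (detached_arith_small _ _ _ hk hn (ltnW gtI)).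
by rewrite -mulnA leq_mul2l.
Qed.

(** * (Sub)sets of [n] and the size of the extremal family *)

Lemma pt_ord {n : nat} (x : 'I_n) : pt n x.+1 = [set x].
Proof. by apply/setP=> y; rewrite !inE eqSS. Qed.

Lemma triangle_free_helly3 {n : nat} (F : {set {set 'I_n}}) : triangle_free F -> helly3 F.
Proof. by move=> tf A B C AF BF CF nAB nAC nBC; apply/eqP=> e; apply: (tf A B C). Qed.

Lemma nontrivial_avoid {n : nat} (F : {set {set 'I_n}}) (c : 'I_n) :
  nontrivial F -> exists2 A, A \in F & c \notin A.
Proof.
move=> nt; have [/exists_inP[A AF cA]|h] := boolP [exists A in F, c \notin A].
  by exists A.
have : c \in \bigcap_(A in F) A.
  apply/bigcapP=> A AF; apply: contraR h => cA.
  by apply/exists_inP; exists A.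
by rewrite nt inE.
Qed.

Lemma card_Tfam (n k : nat) (T0 : {set 'I_n}) : 2 <= k -> 2 <= n -> Tbase k T0 ->
  #|Tfam k T0| = 1 + 'C(n - k - 1, k - 1) + 'C(n - 2, k - 2).
Proof.
move=> k2 n2 [cT0 eT0]; have [p1 p2] : 0 < n /\ 1 < n by rewrite (ltnW n2).
pose a := Ordinal p1; pose b := Ordinal p2.
have nab : a != b by [].
rewrite (pt_ord a) (pt_ord b) in eT0.
have aT0 : a \notin T0 by have /setP/(_ a) := eT0; rewrite !inE eqxx andbT => ->.
have bT0 : b \in T0 by have /setP/(_ b) := eT0; rewrite !inE eqxx orbT andbT => ->.
rewrite inE in cT0; rewrite /Tfam (pt_ord a) (pt_ord b).
have cX : #|[set T in ksets n k | ([set a] \subset T) && (T :&: T0 == set0)]|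
    = 'C(n - k - 1, k - 1).
  have := @card_ksets_between _ [set a] T0 k; rewrite disjoints1 cards1 => /(_ aT0 (ltnW k2)).
  rewrite card_ord (eqP cT0) -subnDA addnC subnDA => <-; apply: eq_card => A.
  by rewrite !inE setI_eq0.
have cY : #|[set T in ksets n k | [set a] :|: [set b] \subset T]| = 'C(n - 2, k - 2).
  have := @card_ksets_over _ [set a; b] k; rewrite cards2 nab card_ord => /(_ k2) <-.
  by apply: eq_card => A; rewrite !inE.
rewrite cardsU cardsU1 cX cY inE sub1set (negbTE aT0) andbF.
rewrite (_ : _ :&: _ = set0) ?cards0 ?subn0 //.
apply/setP=> A; rewrite !inE !subUset !sub1set; apply/negP.
case/andP=> /orP[/eqP->|/andP[_ /andP[_ /eqP e]]]; first by rewrite (negbTE aT0) andbF.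
by case/and3P=> _ _ bA; move/setP/(_ b): e; rewrite !inE bA bT0.
Qed.

Theorem theorem1p10 (n k : nat) (hk : 7 <= k) (hn : 12 * k ^ 2 <= n)
  (F : {set {set 'I_n}}) (hF : F \subset ksets n k)
  (hnt : nontrivial F) (htf : triangle_free F)
  (T0 : {set 'I_n}) (hT0 : Tbase k T0) :
  #|F| <= #|Tfam k T0| /\
  #|Tfam k T0| = 1 + 'C(n - k - 1, k - 1) + 'C(n - 2, k - 2).
Proof.
have k2 : 2 <= k by apply: leq_trans hk.
have n2 : 2 <= n.
  by apply: leq_trans hn; rewrite -[2]muln1 leq_mul // expn_gt0 (leq_trans _ hk).
have cT := card_Tfam n k T0 k2 n2 hT0.
split=> //; rewrite cT -[n in n - k]card_ord -[n in n - 2]card_ord.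
apply: card_nontrivial_helly3 => //; last by move=> c; apply: nontrivial_avoid.
- by move=> A /(subsetP hF); rewrite inE => /eqP.
- exact: triangle_free_helly3.
- by rewrite card_ord.
Qed.
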